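(* Let $b\ge2$ be an integer, let $\gamma\in(1/b,1)$ and let $\psi(x)=-2\pi\sin(2\pi x)$. Then the measure $\vartheta$ on $\mathbb{R}/\mathbb{Z}\times\mathbb{R}$ (the SRB measure of $T$) is absolutely continuous with respect to Lebesgue measure on $\mathbb{R}/\mathbb{Z}\times\mathbb{R}$ and has a square integrable density. In particular, for Lebesgue a.e. $x\in\mathbb{R}$, the measure $m_x$ is absolutely continuous with respect to Lebesgue measure on $\mathbb{R}$ with a square integrable density.
   Context: Let $\mathcal{A}=\{0,1,\dots,b-1\}$ and let $\mathbb{P}$ be the Bernoulli measure on $\mathcal{A}^{\mathbb{Z}^+}$ with uniform weights $1/b$. For $x\in\mathbb{R}$ and $\mathbf{i}=(i_n)_{n\ge1}\in\mathcal{A}^{\mathbb{Z}^+}$ let $S(x,\mathbf{i})=\sum_{n=1}^\infty\gamma^{n-1}\psi\big(\frac{x+i_1+i_2b+\cdots+i_nb^{n-1}}{b^n}\big)$. Let $m_x$ be the push-forward of $\mathbb{P}$ under $\mathbf{i}\mapsto S(x,\mathbf{i})$. Let $T:\mathbb{R}/\mathbb{Z}\times\mathbb{R}\to\mathbb{R}/\mathbb{Z}\times\mathbb{R}$, $T(x,y)=(bx \bmod 1,\ \gamma y+\psi(x))$. Identifying $\mathbb{R}/\mathbb{Z}$ with $[0,1)$, the SRB measure of $T$ is $\vartheta(B)=\int_0^1 m_x(B_x)\,dx$ for Borel $B$, where $B_x=\{y:(x,y)\in B\}$. *)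

(* Defs.v *)
From mathcomp Require Import all_boot all_order all_algebra.
From mathcomp Require Import all_classical all_reals all_analysis.
Set Implicit Arguments. Unset Strict Implicit. Unset Printing Implicit Defensive.
Import Order.TTheory GRing.Theory Num.Theory.
Import numFieldNormedType.Exports.
Local Open Scope classical_set_scope.
Local Open Scope ring_scope.

Definition psi {R : realType} (x : R) : R := - (2 * pi) * sin (2 * pi * x).

(* A model of the Bernoulli measure with uniform weights 1/b on A^{Z+},
   A = {0,..,b-1}: a probability space (Omega, P) together with coordinate
   maps iota n (iota n = i_{n+1}, 0-based), each taking values in A and
   measurable, such that every cylinder [d_1 ... d_N] has probability b^-N.
   This is exactly the definition of the Bernoulli measure via cylinders. *)
Definition bernoulli_model {R : realType} (b : nat) {d : measure_display}
  {Omega : measurableType d} (P : probability Omega R)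
  (iota : nat -> Omega -> nat) : Prop :=
  [/\ (forall n w, (iota n w < b)%N),
      (forall n k, measurable [set w | iota n w = k]) &
      (forall (N : nat) (dig : nat -> nat), (forall j, (j < N)%N -> (dig j < b)%N) ->
         P [set w | forall j, (j < N)%N -> iota j w = dig j] = ((b%:R : R) ^- N)%:E)].

(* S(x, i) = sum_{n>=1} gamma^{n-1} psi((x + i_1 + i_2 b + ... + i_n b^{n-1}) / b^n),
   written 0-based: sum_{n>=0} gamma^n psi((x + sum_{k<=n} i_{k+1} b^k)/b^{n+1}). *)
Definition Sfun {R : realType} (b : nat) (gamma : R) {T : Type}
  (iota : nat -> T -> nat) (x : R) (w : T) : R :=
  limn (fun N : nat => \sum_(0 <= n < N)
     (gamma ^+ n * psi ((x + \sum_(k < n.+1) (iota k w)%:R * (b%:R ^+ k)) / (b%:R ^+ n.+1)))).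

Definition m_x {R : realType} (b : nat) (gamma : R) {d : measure_display}
  {Omega : measurableType d} (P : probability Omega R)
  (iota : nat -> Omega -> nat) (x : R) : set R -> \bar R :=
  pushforward P (Sfun b gamma iota x).

(* The SRB measure, with R/Z identified with [0,1):
   vartheta(B) = int_0^1 m_x(B_x) dx, for B a subset of R x R. *)
Definition vartheta {R : realType} (b : nat) (gamma : R) {d : measure_display}
  {Omega : measurableType d} (P : probability Omega R)
  (iota : nat -> Omega -> nat) (B : set (R * R)) : \bar R :=
  (\int[@lebesgue_measure R]_(x in `[0%R, 1%R[)
      m_x b gamma P iota x [set y | B (x, y)])%E.

(* Main.v *)
Require Import Defs.
From mathcomp Require Import all_boot all_order all_algebra.
From mathcomp Require Import all_classical all_reals all_analysis.
From mathcomp Require Import measurable_realfun ring lra zify.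
Set Implicit Arguments. Unset Strict Implicit. Unset Printing Implicit Defensive.
Import Order.TTheory GRing.Theory Num.Theory.
Import numFieldNormedType.Exports.
Local Open Scope classical_set_scope.
Local Open Scope ring_scope.

(** Let [G_N z = sum_(n < N) gamma^n psi (z / b^(n+1))]. As psi is 1-periodic, the N-th
    partial sum of S(x, i) is [G_N (x + i_1 + i_2 b + ... + i_N b^(N-1))]. The theorem
    follows from a bound T(r) = O(r), where T(r) is the measure of the triples (x, i, j),
    x in [0, 1), with |S(x, i) - S(x, j)| < r; it is proved for the partial sums,
    uniformly in N, with x running through a grid of step b^-L.

    Put h(x) = S(x, i) - S(x, j). Pairs with i_1 = j_1 contribute T(r / gamma) / b. If
    i_1 <> j_1, then h' and h'' are not small simultaneously, so {|h'| <= delta} has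
    measure O(delta). For delta >= sqrt r, the points with |h| < r and |h'| ~ delta fill
    a proportion O(r / delta^2) of the near tangencies {|h| <= delta^2, |h'| <= delta}.
    These are controlled by T itself. Fix the first n digits of i and j, where
    (gamma / b)^n ~ delta^2: this determines h' up to O(delta), hence confines x to a set
    of measure O(delta), and the remaining digits must bring two sums S(y, .) and
    S(y', .) to a prescribed distance up to O(b^-n). Here only the b-adic cells of y and
    y' of length b^-n matter, and by Cauchy-Schwarz the near tangencies have measure
    O(delta T(b^-n)). For delta = b^-q the inequality gamma > 1 / b gives n >= kappa q
    with kappa > 1, so that the series of the b^(q - n(q)) converges and the bound
    T(r) <= C r reproduces itself once C is large.

    Consequently the averages of m_x over balls of radius 2^-k have, for a.e. x, a bounded
    subsequence in L^2. This makes m_x absolutely continuous, and by Lebesgue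
    differentiation and Fatou's lemma its density is square integrable. *)

(** * Trigonometric inequalities *)

Section trig.
Context {R : realType}.
Implicit Types x y : R.

(** Mean value theorem for unordered end points. The bound on [c] turns a Lipschitz estimate for the
    derivative into a quadratic Taylor remainder. *)
Lemma MVT_between (f df : R -> R) x y :
  (forall z : R, is_derive z (1 : R) f (df z)) ->
  exists2 c, f x - f y = df c * (x - y) & `|c - y| <= `|x - y|.
Proof.
move=> fdf.
have cf a b : {within `[a, b], continuous f}%classic.
  by apply: continuous_subspaceT => z; apply: differentiable_continuous;
    apply/derivable1_diffP; exact: ex_derive.
have [xy|/ltW yx] := leP x y.
- have [c /itvP cxy e] := MVT_segment xy (fun z _ => fdf z) (cf x y).
  exists c; first by rewrite -opprB e; ring.
  by rewrite !ler0_norm ?subr_le0 ?cxy// lerN2 lerD2r cxy.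
- have [c /itvP cxy e] := MVT_segment yx (fun z _ => fdf z) (cf y x).
  exists c; first by rewrite e.
  by rewrite !ger0_norm ?subr_ge0 ?cxy// lerD2r cxy.
Qed.

Lemma sin_lip x y : `|sin x - sin y| <= `|x - y|.
Proof.
have [c -> _] := MVT_between x y (fun z => is_derive_sin z).
by rewrite normrM ler_piMl// cos_max.
Qed.
Lemma cos_lip x y : `|cos x - cos y| <= `|x - y|.
Proof.
have [c -> _] := MVT_between x y (fun z => is_derive_cos z).
by rewrite normrM ler_piMl// normrN sin_max.
Qed.
Lemma sin_taylor x y : `|sin x - sin y - cos y * (x - y)| <= (x - y) ^+ 2.
Proof.
have [c -> cxy] := MVT_between x y (fun z => is_derive_sin z).
rewrite -mulrBl normrM -[leRHS]ger0_norm ?sqr_ge0// normrX expr2 ler_wpM2r//.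
exact: le_trans (cos_lip _ _) cxy.
Qed.
Lemma cos_taylor x y : `|cos x - cos y + sin y * (x - y)| <= (x - y) ^+ 2.
Proof.
have [c -> cxy] := MVT_between x y (fun z => is_derive_cos z).
rewrite mulNr addrC -mulrBl normrM -[leRHS]ger0_norm ?sqr_ge0// normrX expr2 ler_wpM2r//.
by apply: le_trans (sin_lip _ _) _; rewrite distrC.
Qed.

(** Concavity of the sine: if the graph lay below the chord at [x], the mean value theorem would
    give [cos u < 2 / pi] for some [u < x] and [cos v > 2 / pi] for some [v > x], although the
    cosine decreases. *)
Lemma jordan x : 0 <= x <= pi / 2 -> 2 * x / pi <= sin x.
Proof.
move=> /andP[]; rewrite le_eqVlt => /predU1P[<-|x0]; first by rewrite sin0 mulr0 mul0r.
rewrite le_eqVlt => /predU1P[->|xpi].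
  by rewrite sin_pihalf mulrCA divff// mulr1 divff// gt_eqF// pi_gt0.
rewrite leNgt; apply/negP => lt.
have pi0 := @pi_gt0 R.
have d (z : R) : is_derive z 1 (fun x : R => sin x - x * (2 / pi)) (cos z - 2 / pi).
  apply: is_derive_eq; rewrite scaler0 !add0r; by rewrite /GRing.scale/= mulr1.
have c a c : {within `[a, c], continuous (fun x : R => sin x - x * (2 / pi))}%classic.
  by apply: continuous_subspaceT => z; apply: differentiable_continuous;
    apply/derivable1_diffP; exact: ex_derive.
have [u /[!in_itv]/= /andP[u0 ux] eu] := MVT x0 (fun z _ => d z) (c _ _).
have [v /[!in_itv]/= /andP[xv vpi] ev] := MVT xpi (fun z _ => d z) (c _ _).
have cuv : cos v < cos u.
  by rewrite ltr_cos ?in_itv/=; lra.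
have e : 2 * x / pi = x * (2 / pi) by rewrite (mulrC 2) mulrA.
rewrite e in lt.
rewrite sin0 mul0r subr0 !subr0 in eu.
rewrite sin_pihalf in ev.
have e2 : pi / 2 * (2 / pi) = 1 :> R by rewrite mulrA divfK ?divff ?gt_eqF.
rewrite e2 subrr sub0r in ev.
have h1 : cos u - 2 / pi < 0.
  rewrite -(pmulr_llt0 _ x0); lra.
have h2 : 0 < cos v - 2 / pi.
  have xp : 0 < pi / 2 - x by lra.
  rewrite -(pmulr_lgt0 _ xp); lra.
lra.
Qed.
End trig.

(** * Counting *)

Section counting.
Context {R : realType}.

(** Euclidean division of the index by [m]. For [m = b ^ n] it separates the first [n] digits of a
    word from the remaining ones. *)
Lemma sum_digits (m n : nat) (F : nat -> R) :
  \sum_(i < m * n) F i = \sum_(i < m) \sum_(j < n) F (i + m * j)%N.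
Proof.
rewrite exchange_big/=; elim: n => [|n IH]; first by rewrite muln0 !big_ord0.
rewrite big_ord_recr/= -IH mulnSr -!(big_mkord xpredT F).
rewrite (big_cat_nat (leq0n (m * n)%N) (leq_addr _ _))/=; congr (_ + _).
by rewrite -{1}[(m * n)%N]add0n big_addn addKn big_mkord.
Qed.

Lemma sum_interval (m i0 t : nat) :
  (\sum_(i < m) ((i0 <= i)%N && (i < i0 + t)%N) <= minn (m - i0) t)%N.
Proof.
elim: m => [|m IH]; first by rewrite big_ord0.
rewrite big_ord_recr/=; move: IH; set s := (\sum_(i < m) _)%N.
case: (leqP i0 m) => h1; case: (ltnP m (i0 + t)) => h2 /=; lia.
Qed.

(** All indices counted lie in a block of [Num.truncn D + 1] integers that starts at the least of
    them. *)
Lemma count_diam (m : nat) (P : pred nat) (D : R) : 0 <= D ->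
  (forall i i', P i -> P i' -> (i < m)%N -> (i' < m)%N -> (i <= i')%N ->
     (i' - i)%:R <= D) ->
  \sum_(i < m) (P i)%:R <= D + 1.
Proof.
move=> D0 PD; have [[i1 Pi1]|nP] := pselect (exists i, P i && (i < m)%N); last first.
  rewrite big1 ?addr_ge0// => i _; case: (boolP (P i)) => // Pi.
  by exfalso; apply: nP; exists i; rewrite Pi ltn_ord.
have := ex_minnP (ex_intro (fun i => P i && (i < m)%N) i1 Pi1).
case=> i0 /andP[Pi0 i0m] mini0.
pose t := (Num.truncn D).+1.
apply: (@le_trans _ _ (\sum_(i < m) ((i0 <= i)%N && (i < i0 + t)%N))%:R).
  rewrite natr_sum; apply: ler_sum => i _; rewrite ler_nat.
  case: (boolP (P i)) => // Pi; have i0i := mini0 i.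
  rewrite Pi ltn_ord/= in i0i; rewrite (i0i isT)/=.
  have le := PD _ _ Pi0 Pi i0m (ltn_ord i) (i0i isT).
  have /andP[_ Dt] := truncn_itv D0.
  move: (le_lt_trans le Dt); rewrite ltr_nat -/t => {le Dt} lt.
  by move: (i0i isT) lt; case: (ltnP i (i0 + t)) => //; lia.
have /andP[tD _] := truncn_itv D0.
apply: (@le_trans _ _ t%:R); last by rewrite -natr1 lerD2r.
by rewrite ler_nat (leq_trans (sum_interval _ _ _))// geq_minr.
Qed.

Lemma exp_floor (r t : R) : 0 < r < 1 -> 0 < t <= 1 ->
  exists n, r ^+ n.+1 < t <= r ^+ n.
Proof.
move=> /andP[r0 r1] /andP[t0 t1].
have [n tn] : exists n, r ^+ n < t.
  have : (r ^+ n @[n --> \oo] --> (0 : R))%classic by apply: cvg_expr; rewrite gtr0_norm.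
  move=> /cvgrPdist_lt/(_ _ t0)[n _ /(_ n)]/=; rewrite sub0r normrN => h; exists n.
  by rewrite -[X in X < _]gtr0_norm ?exprn_gt0// h.
elim: n tn => [|n IH] tn; first by rewrite expr0 ltNge t1 in tn.
have [/IH//|tn'] := ltP (r ^+ n) t.
by exists n; rewrite tn tn'.
Qed.

Lemma expr_small (r t : R) : 0 < r < 1 -> 0 < t -> exists n, r ^+ n < t.
Proof.
move=> r01 t0.
have [n /andP[h _]] : exists n, r ^+ n.+1 < Num.min t 1 <= r ^+ n.
  by apply: exp_floor => //; rewrite lt_min t0 ltr01 ge_min lexx orbT.
by exists n.+1; apply: lt_le_trans h _; rewrite ge_min lexx.
Qed.

Lemma sum_eq_mem (T : eqType) (s : seq T) (x : T) (F : T -> R) : uniq s -> x \in s ->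
  \sum_(k <- s) (x == k)%:R * F k = F x.
Proof.
move=> us xs; rewrite (bigD1_seq x)//= eqxx mul1r big1 ?addr0// => k kx.
by rewrite eq_sym (negbTE kx) mul0r.
Qed.

(** Sorted by their common value [k], the pairs number [cn u k * cn v k], and
    [2 * x * y <= x ^+ 2 + y ^+ 2] applies to each term. This is the Cauchy-Schwarz step that
    decouples two different starting points. *)
Lemma pairs_le_diag (T : eqType) (m : nat) (u v : nat -> T) :
  \sum_(i < m) \sum_(j < m) (u i == v j)%:R <=
  2^-1 * (\sum_(i < m) \sum_(j < m) (u i == u j)%:R +
          \sum_(i < m) \sum_(j < m) (v i == v j)%:R) :> R.
Proof.
pose s := undup ([seq u i | i <- iota 0 m] ++ [seq v i | i <- iota 0 m]).
have us : uniq s by rewrite undup_uniq.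
have su (i : 'I_m) : u i \in s.
  by rewrite mem_undup mem_cat map_f// mem_iota/= add0n ltn_ord.
have sv (i : 'I_m) : v i \in s.
  by rewrite mem_undup mem_cat orbC map_f// mem_iota/= add0n ltn_ord.
pose cn (f : nat -> T) k : R := \sum_(i < m) (f i == k)%:R.
have key (f h : nat -> T) : (forall i : 'I_m, f i \in s) ->
    \sum_(i < m) \sum_(j < m) (f i == h j)%:R = \sum_(k <- s) cn f k * cn h k.
  move=> sf.
  transitivity (\sum_(k <- s) \sum_(i < m) (f i == k)%:R * cn h k).
    rewrite [RHS]exchange_big/=; apply: eq_bigr => i _.
    rewrite (@sum_eq_mem _ s (f i) (cn h))//.
    by apply: eq_bigr => j _; rewrite eq_sym.
  by apply: eq_bigr => k _; rewrite -mulr_suml.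
rewrite !key// -big_split/= mulr_sumr; apply: ler_sum => k _.
have := sqr_ge0 (cn u k - cn v k); rewrite sqrrB; lra.
Qed.

(* Values are grouped into cells of length [t]; two values at distance less than
   [t] lie in the same or in adjacent cells. *)
Lemma near_pairs_le (m : nat) (u v : nat -> R) (c t : R) : 0 < t ->
  \sum_(i < m) \sum_(j < m) (`|c + (u i - v j)| < t)%R%:R <=
  3 / 2 * (\sum_(i < m) \sum_(j < m) (`|u i - u j| < t)%R%:R +
           \sum_(i < m) \sum_(j < m) (`|v i - v j| < t)%R%:R) :> R.
Proof.
move=> t0; set X := (X in _ <= 3 / 2 * X).
pose fl x := Num.floor (x / t).
have fl_near x y : fl x = fl y -> `|x - y| < t.
  rewrite /fl => e.
  have /andP[x1 x2] := floor_itv (x / t).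
  have /andP[y1 y2] := floor_itv (y / t).
  rewrite e in x1 x2; rewrite intrD in x2 y2.
  have : `|x / t - y / t| < 1 by rewrite ltr_norml; apply/andP; split; lra.
  by rewrite -mulrBl normrM normfV (gtr0_norm t0) ltr_pdivrMr// mul1r.
have near_fl x y : `|x - y| < t -> [|| fl x == fl y, fl x == fl y + 1 | fl x == fl y - 1].
  move=> xy.
  have : `|x / t - y / t| < 1.
    by rewrite -mulrBl normrM normfV (gtr0_norm t0) ltr_pdivrMr// mul1r.
  rewrite ltr_norml => /andP[d1 d2].
  have /andP[x1 x2] := floor_itv (x / t).
  have /andP[y1 y2] := floor_itv (y / t).
  rewrite -/(fl x) in x1 x2; rewrite -/(fl y) in y1 y2.
  rewrite intrD in x2 y2.
  have h1 : ((fl x)%:~R < (fl y)%:~R + 2 :> R) by lra.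
  have h2 : ((fl y)%:~R < (fl x)%:~R + 2 :> R) by lra.
  have h1' : fl x < fl y + 2 by rewrite -(ltr_int R) intrD.
  have h2' : fl y < fl x + 2 by rewrite -(ltr_int R) intrD.
  clear -h1' h2'; lia.
(* The constant [c] enters only the cells of [u], where it cancels in differences. The shifts
   [e = 0, 1, -1] account for equal and adjacent cells, each at the price [2^-1 * X]. *)
pose U i := fl (c + u i); pose V (e : int) j := fl (v j) + e.
have step (e : int) : \sum_(i < m) \sum_(j < m) (U i == V e j)%:R <=
  2^-1 * X.
  apply: le_trans (pairs_le_diag m U (V e)) _.
  rewrite ler_pM2l ?invr_gt0//; apply: lerD; apply: ler_sum => i _; apply: ler_sum => j _;
    rewrite ler_nat; case: eqP => //=.
    by move=> /fl_near; rewrite (_ : c + u i - (c + u j) = u i - u j) ?[RHS]opprD; [move=> ->|ring].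
  by move=> /addIr/fl_near ->.
have -> : 3 / 2 * X = 2^-1 * X + 2^-1 * X + 2^-1 * X by lra.
apply: (@le_trans _ _ (\sum_(i < m) \sum_(j < m) (U i == V 0 j)%:R +
  \sum_(i < m) \sum_(j < m) (U i == V 1 j)%:R + \sum_(i < m) \sum_(j < m) (U i == V (-1) j)%:R));
  last by rewrite !lerD.
rewrite -!big_split/=; apply: ler_sum => i _; rewrite -!big_split/=; apply: ler_sum => j _.
case: (ltP `|_| t) => [h|_]; last by rewrite !addr_ge0.
have := @near_fl (c + u i) (v j); rewrite -[X in `|X| < _]addrA => /(_ h).
rewrite /U /V addr0 -!natrD ler_nat => /or3P[] ->; lia.
Qed.
End counting.

(** * Near tangencies *)

Section windows.
Context {R : realType} (b : nat).
Hypothesis b2 : (2 <= b)%N.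
Local Notation beta := (b%:R : R).

Lemma beta_ge2 : 2 <= beta. Proof. by rewrite ler_nat. Qed.
Lemma beta_gt0 : 0 < beta. Proof. by have := beta_ge2; lra. Qed.
Lemma betaX_gt0 n : 0 < beta ^+ n. Proof. by rewrite exprn_gt0// beta_gt0. Qed.
Lemma betaVX_gt0 n : 0 < beta ^- n. Proof. by rewrite invr_gt0 betaX_gt0. Qed.
Lemma betaX_ge1 n : 1 <= beta ^+ n.
Proof. by rewrite exprn_ege1//; have := beta_ge2; lra. Qed.
Lemma ler_betaX m n : (m <= n)%N -> beta ^+ m <= beta ^+ n.
Proof. by move=> mn; rewrite ler_eXn2l//; have := beta_ge2; lra. Qed.
Lemma ler_betaVX m n : (m <= n)%N -> beta ^- n <= beta ^- m.
Proof. by move=> mn; rewrite lef_pV2 ?posrE ?betaX_gt0// ler_betaX. Qed.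
Lemma betaXV n : beta ^+ n * beta ^- n = 1.
Proof. by rewrite divff// gt_eqF// betaX_gt0. Qed.

Definition in_window (q a : nat) (x : R) := a%:R / beta ^+ q <= x < a.+1%:R / beta ^+ q.

Lemma window_dist q a x y : in_window q a x -> in_window q a y -> `|x - y| <= beta ^- q.
Proof.
rewrite /in_window -natr1 mulrDl mul1r => /andP[x1 x2] /andP[y1 y2].
by rewrite ler_norml; apply/andP; split; lra.
Qed.

Lemma window_left q a : in_window q a (a%:R / beta ^+ q).
Proof. by rewrite /in_window lexx/= ltr_pM2r ?betaVX_gt0// ltr_nat. Qed.

Lemma grid_in_window q L a i : (q <= L)%N -> (i < b ^ (L - q))%N ->
  in_window q a ((i + b ^ (L - q) * a)%:R / beta ^+ L).
Proof.
move=> qL ib; have e : beta ^+ L = beta ^+ (L - q) * beta ^+ q by rewrite -exprD subnK.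
have -> : (i + b ^ (L - q) * a)%:R / beta ^+ L = (a%:R + i%:R / beta ^+ (L - q)) / beta ^+ q.
  rewrite e invfM natrD natrM natrX mulrA; congr (_ / _).
  rewrite mulrDl mulrAC betaXV mul1r; exact: addrC.
rewrite /in_window ler_pM2r ?betaVX_gt0// ltr_pM2r ?betaVX_gt0//.
rewrite lerDl divr_ge0 ?(ltW (betaX_gt0 _))//= -natr1 ltrD2l.
by rewrite ltr_pdivrMr ?betaX_gt0// mul1r -natrX ltr_nat.
Qed.

Lemma grid_sum_windows q L (cl : R -> bool) : (q <= L)%N ->
  \sum_(j < b ^ L) (cl (j%:R / beta ^+ L))%:R =
  \sum_(a < b ^ q) \sum_(i < b ^ (L - q)) (cl ((i + b ^ (L - q) * a)%:R / beta ^+ L))%:R :> R.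
Proof.
move=> qL; have -> : (b ^ L)%N = (b ^ (L - q) * b ^ q)%N by rewrite -expnD subnK.
by rewrite (sum_digits _ _ (fun j => (cl (j%:R / beta ^+ L))%:R)) exchange_big.
Qed.

Lemma grid_sum_le q L (cl : R -> bool) (cond : nat -> bool) (M : R) : (q <= L)%N -> 0 <= M ->
  (forall a x, in_window q a x -> cl x -> cond a) ->
  (forall a, \sum_(i < b ^ (L - q)) (cl ((i + b ^ (L - q) * a)%:R / beta ^+ L))%:R <= M) ->
  \sum_(j < b ^ L) (cl (j%:R / beta ^+ L))%:R <= M * \sum_(a < b ^ q) (cond a)%:R.
Proof.
move=> qL M0 clcond clM; rewrite (grid_sum_windows _ qL) mulr_sumr; apply: ler_sum => a _.
have [ca|nca] := boolP (cond a); first by rewrite mulr1.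
rewrite mulr0 big1// => i _; case: (boolP (cl _)) => // cli.
by rewrite (clcond a _ _ cli) ?grid_in_window// in nca.
Qed.

Lemma window_count q L a (cl : R -> bool) (D : R) : (q <= L)%N -> 0 <= D ->
  (forall x y, in_window q a x -> in_window q a y -> cl x -> cl y -> `|x - y| <= D) ->
  \sum_(i < b ^ (L - q)) (cl ((i + b ^ (L - q) * a)%:R / beta ^+ L))%:R <= D * beta ^+ L + 1.
Proof.
move=> qL D0 clD.
apply: (@count_diam R _ (fun i => cl ((i + b ^ (L - q) * a)%:R / beta ^+ L))).
  by rewrite mulr_ge0// ltW// betaX_gt0.
move=> i i' cli cli' ib ib' ii'.
have := clD _ _ (grid_in_window a qL ib') (grid_in_window a qL ib) cli' cli.
rewrite -mulrBl !natrD opprD addrACA subrr addr0 -natrB// normrM ger0_norm//.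
by rewrite ger0_norm ?invr_ge0 ?(ltW (betaX_gt0 _))// ler_pdivrMr ?betaX_gt0.
Qed.

(** * Level sets of a function with Lipschitz derivative *)

Section transversality.
Variables (h h1 : R -> R) (K : R).
Hypothesis K1 : 1 <= K.
Hypothesis h1_lip : forall x y, `|h1 x - h1 y| <= K * `|x - y|.
Hypothesis h_taylor : forall x y, `|h x - h y - h1 y * (x - y)| <= K * (x - y) ^+ 2.

(** The slope at [y] exceeds [s] by enough to absorb the Taylor remainder. *)
Lemma taylor_lb x y (s : R) : `|h1 y| >= s + K * `|x - y| -> s * `|x - y| <= `|h x - h y|.
Proof.
move=> sy; have t := h_taylor x y.
have t2 : `|h1 y * (x - y)| <= `|h x - h y| + K * (x - y) ^+ 2.
  have -> : h1 y * (x - y) = (h x - h y) - (h x - h y - h1 y * (x - y)) by ring.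
  by apply: le_trans (ler_normB _ _) _; rewrite lerD2l.
rewrite normrM -real_normK ?num_real// in t2.
have t3 : (s + K * `|x - y|) * `|x - y| <= `|h1 y| * `|x - y| by rewrite ler_wpM2r.
move: t2 t3; rewrite mulrDl expr2; lra.
Qed.

Lemma taylor_ub x y : `|h x| <= `|h y| + `|h1 y| * `|x - y| + K * `|x - y| ^+ 2.
Proof.
have t := h_taylor x y.
have -> : h x = (h x - h y - h1 y * (x - y)) + (h y + h1 y * (x - y)) by ring.
apply: le_trans (ler_normD _ _) _; rewrite addrC; apply: lerD.
  by apply: le_trans (ler_normD _ _) _; rewrite normrM.
by rewrite real_normK ?num_real.
Qed.

Lemma h1_ub x y : `|h1 x| <= `|h1 y| + K * `|x - y|.
Proof.
have -> : h1 x = h1 y + (h1 x - h1 y) by ring.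
by apply: le_trans (ler_normD _ _) _; rewrite lerD2l.
Qed.

Lemma class_exists (H t : R) Q : 0 < H -> t <= H ->
  (exists2 q, (q < Q)%N & H * beta ^- q.+1 < t <= H * beta ^- q) \/ t <= H * beta ^- Q.
Proof.
move=> H0 tH; elim: Q => [|Q [[q qQ hq]|hQ]].
- by right; rewrite expr0 invr1 mulr1.
- by left; exists q => //; exact: ltnW.
- have [t1|t1] := leP t (H * beta ^- Q.+1); first by right.
  by left; exists Q => //; rewrite t1 hQ.
Qed.

(** Cost of passing from a point of a window to its left end: for [h], the term 1 bounds the value
    itself, [2 * beta * K] the slope times the window length, and [K] the Taylor remainder. *)
Definition tangent_const := 1 + (2 * beta + 1) * K.

Definition near_tangent q (a : nat) :=
  (`|h (a%:R / beta ^+ q)| <= tangent_const * beta ^- (2 * q)) &&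
  (`|h1 (a%:R / beta ^+ q)| <= tangent_const * beta ^- q).

(* The set where [|h| < r] is sorted by the size [beta ^- q] of [h1]: in a window of
   length [beta ^- q] it then has length [O(r * beta ^+ q)], and the left end of the
   window is itself nearly a tangency, at scale [beta ^- q]. *)
Lemma level_sum L Q r : (forall x, `|h1 x| <= K) ->
  beta ^- L <= r -> beta ^- (2 * Q.+1) < r <= beta ^- (2 * Q) ->
  \sum_(j < b ^ L) (`|h (j%:R / beta ^+ L)| < r)%R%:R <=
  \sum_(q < Q.+1) (3 * beta ^+ 2 * r * beta ^+ (q + L)) * \sum_(a < b ^ q) (near_tangent q a)%:R.
Proof.
move=> h1K Lr /andP[Qr rQ].
have r0 : 0 < r by apply: lt_le_trans Lr; exact: betaVX_gt0.
have bb := beta_ge2.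
have QL : (Q <= L)%N.
  have : beta ^- L <= beta ^- (2 * Q) by exact: le_trans rQ.
  rewrite lef_pV2 ?posrE ?betaX_gt0// ler_eXn2l//; [lia|lra].
(* The factor [2 * beta] makes the lower end of a class, [H * beta ^- q.+1], equal to
   [2 * K * beta ^- q]: twice the variation of [h1] over a window of length [beta ^- q]. *)
pose H := 2 * beta * K.
have K0 : 0 < K := lt_le_trans ltr01 K1.
have H0 : 0 < H by rewrite !mulr_gt0//; lra.
have KH : K <= H by rewrite /H ler_peMl//; lra.
pose cl q x := [&& `|h x| < r, `|h1 x| <= H * beta ^- q &
   (q == Q) || (H * beta ^- q.+1 < `|h1 x|)].
apply: (@le_trans _ _ (\sum_(q < Q.+1) \sum_(j < b ^ L) (cl q (j%:R / beta ^+ L))%:R)).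
  rewrite exchange_big/=; apply: ler_sum => j _.
  set x := _ / _; have [hx|//] := ltP `|h x| r; last by rewrite sumr_ge0.
  suff [q clq] : exists q : 'I_Q.+1, cl q x.
    by rewrite (bigD1 q)//= clq lerDl sumr_ge0.
  have [[q qQ /andP[q1 q2]]|hQ] := class_exists Q H0 (le_trans (h1K x) KH).
    by exists (Ordinal (ltnW qQ : q < Q.+1)%N); rewrite /cl hx q2 q1 orbT.
  by exists ord_max; rewrite /cl/= hx hQ eqxx.
apply: ler_sum => -[q /= qQ] _; rewrite ltnS in qQ.
have rq : r <= beta ^- (2 * q) by apply: le_trans rQ _; rewrite ler_betaVX// leq_mul2l.
have M1 : 1 <= r * beta ^+ (q + L).
  have rL : 1 <= r * beta ^+ L by rewrite -ler_pdivrMr ?betaX_gt0// div1r.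
  by apply: le_trans rL _; rewrite ler_wpM2l ?(ltW r0)// ler_betaX// leq_addl.
apply: (@grid_sum_le q L (cl q) (near_tangent q)).
- exact: leq_trans QL.
- by rewrite !mulr_ge0// ltW// ?betaX_gt0.
- move=> a x ax /and3P[hx h1x _].
  have d := window_dist (window_left q a) ax.
  have bq : beta ^- (2 * q) = beta ^- q * beta ^- q.
    by rewrite mul2n -addnn exprD invfM.
  have B0 := betaVX_gt0 q.
  have hK2 : K * `|a%:R / beta ^+ q - x| <= K * beta ^- q by rewrite ler_wpM2l// ltW.
  apply/andP; split.
    apply: le_trans (taylor_ub _ x) _.
    have -> : tangent_const * beta ^- (2 * q) =
      beta ^- (2 * q) + (H * beta ^- q) * beta ^- q + K * beta ^- q ^+ 2.
      by rewrite /tangent_const /H bq; ring.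
    rewrite lerD//; first (rewrite lerD//; first exact: le_trans (ltW hx) rq).
      by rewrite ler_pM.
    by rewrite ler_wpM2l ?ler_pXn2r ?nnegrE// ltW.
  apply: le_trans (h1_ub _ x) _.
  have -> : tangent_const * beta ^- q = beta ^- q + H * beta ^- q + K * beta ^- q.
    by rewrite /tangent_const /H; ring.
  by move: h1x hK2 B0; lra.
- move=> a; case: (eqVneq q Q) => [qeQ|qneQ].
    (* The last class has no lower bound on the slope, so all grid points of the window are counted;
       [r > beta ^- (2 * Q.+1)] makes the claimed bound large enough. *)
    subst q; apply: (@le_trans _ _ (\sum_(i < b ^ (L - Q)) 1)).
      by apply: ler_sum => i _; rewrite lern1 leq_b1.
    rewrite sumr_const card_ord -mulr_natl mulr1 natrX.
    have -> : 3 * beta ^+ 2 * r * beta ^+ (Q + L) =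
       3 * (r * beta ^+ (2 * Q.+1)) * beta ^+ (L - Q).
      have e : beta ^+ 2 * beta ^+ (Q + L) = beta ^+ (2 * Q.+1) * beta ^+ (L - Q).
        by rewrite -!exprD; congr (_ ^+ _); lia.
      by transitivity (3 * r * (beta ^+ 2 * beta ^+ (Q + L))); [ring|rewrite e; ring].
    rewrite ler_peMl ?(ltW (betaX_gt0 _))//.
    have : 1 < r * beta ^+ (2 * Q.+1) by rewrite -ltr_pdivrMr ?betaX_gt0// div1r.
    by lra.
  apply: le_trans (@window_count q L a (cl q) (2 * r * beta ^+ q) _ _ _) _.
  - exact: leq_trans QL.
  - by rewrite !mulr_ge0// ltW// betaX_gt0.
  (* Between two points of the class [h] expands distances by at least [K * beta ^- q], while its
     values differ by at most [2 * r]. *)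
  - move=> x y ax ay /and3P[hx _ _] /and3P[hy _]; rewrite (negbTE qneQ)/= => h1y.
    have d := window_dist ax ay.
    have := @taylor_lb x y (K * beta ^- q).
    have e : H * beta ^- q.+1 = 2 * (K * beta ^- q).
      rewrite /H exprS invfM; field.
      by rewrite !gt_eqF ?betaX_gt0 ?beta_gt0.
    have hK2 : K * `|x - y| <= K * beta ^- q by rewrite ler_wpM2l// ltW.
    have -> : K * beta ^- q + K * `|x - y| <= `|h1 y| by move: h1y; rewrite e; lra.
    move=> /(_ isT) hxy.
    have h2r : `|h x - h y| <= 2 * r by apply: le_trans (ler_normB _ _) _; lra.
    have : beta ^- q * `|x - y| <= 2 * r.
      apply: le_trans h2r; apply: le_trans hxy; rewrite ler_wpM2r//.
      by rewrite ler_peMl// ltW// betaVX_gt0.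
    by rewrite ler_pdivrMl ?betaX_gt0// mulrC.
  have b4 : 4 <= beta ^+ 2 by rewrite expr2; nra.
  have -> : 2 * r * beta ^+ q * beta ^+ L = 2 * (r * beta ^+ (q + L)) by rewrite exprD; ring.
  have -> : 3 * beta ^+ 2 * r * beta ^+ (q + L) = 3 * (beta ^+ 2 * (r * beta ^+ (q + L))).
    by ring.
  have : 4 * (r * beta ^+ (q + L)) <= beta ^+ 2 * (r * beta ^+ (q + L)).
    by rewrite ler_wpM2r//; move: M1; lra.
  by move: M1; lra.
Qed.

End transversality.

(* Where [h1] is small its derivative [h2] is bounded away from 0, so in each window of
   length [beta ^- p] the near zeros of [h1] lie within [O(beta ^- q)] of each other. *)
Lemma critical_count (h1 h2 : R -> R) (K c0 C : R) p q : 0 < c0 -> 0 <= C ->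
  (forall x y, `|h1 x - h1 y - h2 y * (x - y)| <= K * (x - y) ^+ 2) ->
  (forall x, c0 <= `|h1 x| \/ c0 <= `|h2 x|) -> 0 <= K ->
  K * beta ^- p <= c0 / 2 -> C * beta ^- p < c0 ->
  \sum_(a < b ^ q) (`|h1 (a%:R / beta ^+ q)| <= C * beta ^- q)%R%:R <=
  beta ^+ p * (4 * C / c0 + 1).
Proof.
move=> c00 C0 tay nd K0 Kp Cp.
have M0 : 0 <= 4 * C / c0 by rewrite divr_ge0 ?mulr_ge0// ltW.
(* For [q <= p] there are at most [beta ^+ p] points in all; otherwise they are counted inside each
   of the [b ^ p] windows of length [beta ^- p]. *)
have [qp|pq] := leqP q p.
  apply: (@le_trans _ _ (\sum_(a < b ^ q) 1)).
    by apply: ler_sum => i _; rewrite lern1 leq_b1.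
  rewrite sumr_const card_ord -mulr_natl mulr1 natrX.
  apply: le_trans (ler_betaX qp) _; rewrite ler_peMr ?(ltW (betaX_gt0 _))//; lra.
pose cl x := `|h1 x| <= C * beta ^- q.
apply: le_trans (@grid_sum_le p q cl xpredT (4 * C / c0 + 1) (ltnW pq) _ _ _) _.
- by rewrite addr_ge0.
- by [].
- move=> a; apply: le_trans (@window_count p q a cl (4 * C / c0 * beta ^- q) (ltnW pq) _ _) _.
  + by rewrite mulr_ge0// ltW// betaVX_gt0.
  + move=> x y ax ay; rewrite /cl => hx hy.
    have d := window_dist ax ay.
    (* At this scale [h1 y] is smaller than [c0], which leaves the alternative for [h2 y]; hence
       [h1] expands distances by [c0 / 2] within the window. *)
    have Cq : C * beta ^- q < c0.
      by apply: le_lt_trans Cp; rewrite ler_wpM2l// ler_betaVX// ltnW.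
    have h2y : c0 <= `|h2 y| by case: (nd y) => // h1y; move: hy Cq h1y; lra.
    have : c0 / 2 * `|x - y| <= `|h1 x - h1 y|.
      apply: (taylor_lb tay).
      have : K * `|x - y| <= K * beta ^- p by rewrite ler_wpM2l.
      by move: Kp h2y; lra.
    have : `|h1 x - h1 y| <= 2 * (C * beta ^- q).
      by apply: le_trans (ler_normB _ _) _; move: hx hy; lra.
    move=> h12 /le_trans/(_ h12) h3.
    rewrite -(ler_pM2l (_ : 0 < c0 / 2)); last by lra.
    have -> : c0 / 2 * (4 * C / c0 * beta ^- q) = 2 * (C * beta ^- q).
      field.
      by rewrite ?gt_eqF ?betaX_gt0.
    exact: h3.
  + by rewrite -mulrA mulVf ?gt_eqF ?betaX_gt0// mulr1.
by rewrite sumr_const card_ord -mulr_natl mulr1 natrX mulrC.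
Qed.

End windows.

(** * The series and its derivatives *)

Section series.
Context {R : realType} (b : nat) (g : R).
Hypothesis b2 : (2 <= b)%N.
Hypotheses (g0 : 0 < g) (g1 : g < 1).
Local Notation beta := (b%:R : R).

(* For [k = 0, 1, 2] and [f] the [k]-th derivative of psi, this is the [k]-th derivative
   in [z] of the [N]-th partial sum of S; by periodicity of psi that partial sum at
   [(x, i)] only depends on [z = x + i_1 + i_2 b + ... + i_N b^(N-1)]. *)
Definition ser (k N : nat) (f : R -> R) (z : R) : R :=
  \sum_(n < N) g ^+ n * beta ^- (k * n.+1) * f (z / beta ^+ n.+1).

Lemma ser_split k n N f z :
  ser k (n + N) f z = ser k n f z + g ^+ n * beta ^- (k * n) * ser k N f (z / beta ^+ n).
Proof.
rewrite /ser big_split_ord/=; congr (_ + _); rewrite mulr_sumr; apply: eq_bigr => i _.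
rewrite -addnS mulnDr !exprD !invfM !mulrA; congr (_ * f _); ring.
Qed.

Lemma ser_periodic k n f z (m : nat) : (forall x (m : nat), f (x + m%:R) = f x) ->
  ser k n f (z + (b ^ n * m)%:R) = ser k n f z.
Proof.
move=> fp; apply: eq_bigr => i _; congr (_ * _).
have -> : (z + (b ^ n * m)%:R) / beta ^+ i.+1 = z / beta ^+ i.+1 + (b ^ (n - i.+1) * m)%:R.
  rewrite mulrDl; congr (_ + _).
  rewrite -{1}(subnK (ltn_ord i)) expnD mulnAC natrM [(b ^ i.+1)%:R]natrX mulfK//.
  by rewrite gt_eqF// betaX_gt0.
exact: fp.
Qed.

(** Self-similarity of S: the low digits [w0] alone fix the first [n] terms, since [b ^ n * w1] is a
    period of each of them, and the other terms form a contracted copy of the series at a point of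
    the [n]-th preimage of [x]. *)
Lemma ser_digits k n N f x (w0 w1 : nat) : (forall x (m : nat), f (x + m%:R) = f x) ->
  ser k (n + N) f (x + (w0 + b ^ n * w1)%:R) =
  ser k n f (x + w0%:R) + g ^+ n * beta ^- (k * n) * ser k N f ((x + w0%:R) / beta ^+ n + w1%:R).
Proof.
move=> fp; rewrite ser_split natrD addrA ser_periodic//; congr (_ + _ * ser _ _ _ _).
by rewrite mulrDl natrM natrX mulrAC betaXV// mul1r.
Qed.

Lemma geometric_sum_le N (a : nat -> R) (M : R) : 0 <= M ->
  (forall n, `|a n| <= g ^+ n * M) -> `|\sum_(n < N) a n| <= M / (1 - g).
Proof.
move=> M0 aM; apply: le_trans (ler_norm_sum _ _ _) _.
apply: (@le_trans _ _ (\sum_(n < N) g ^+ n * M)); first exact: ler_sum.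
rewrite -mulr_suml mulrC ler_wpM2l//.
have g1' : 0 < 1 - g by rewrite subr_gt0.
rewrite -[leRHS]mul1r ler_pdivlMr//.
have : 0 <= g ^+ N by rewrite exprn_ge0// ltW.
have := subrX1 g N; rewrite -opprB => /eqP; rewrite eqr_oppLR => /eqP; lra.
Qed.

Let betaV_itv m : 0 < beta ^- m <= 1.
Proof. by rewrite betaVX_gt0// invf_le1 ?betaX_gt0// betaX_ge1. Qed.

Lemma ser_bound k N f B z : 0 <= B -> (forall x, `|f x| <= B) -> `|ser k N f z| <= B / (1 - g).
Proof.
move=> B0 fB; apply: (@geometric_sum_le _ (fun n => g ^+ n * beta ^- (k * n.+1) * f (z / beta ^+ n.+1))) => // n.
have /andP[p0 p1] := betaV_itv (k * n.+1).
rewrite normrM normrM (ger0_norm (ltW p0)) (ger0_norm (exprn_ge0 _ (ltW g0))) -mulrA.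
by rewrite ler_wpM2l ?exprn_ge0 ?(ltW g0)// -[B]mul1r ler_pM// ltW.
Qed.

Lemma ser_lip k N f B x y : 0 <= B -> (forall x y, `|f x - f y| <= B * `|x - y|) ->
  `|ser k N f x - ser k N f y| <= B / (1 - g) * `|x - y|.
Proof.
move=> B0 fB; rewrite -sumrB mulrAC.
apply: (@geometric_sum_le _ (fun n => g ^+ n * beta ^- (k * n.+1) * f (x / beta ^+ n.+1) -
  g ^+ n * beta ^- (k * n.+1) * f (y / beta ^+ n.+1))); first by rewrite mulr_ge0.
move=> n; have /andP[p0 p1] := betaV_itv (k * n.+1); have /andP[q0 q1] := betaV_itv n.+1.
rewrite -mulrBr normrM normrM (ger0_norm (ltW p0)) (ger0_norm (exprn_ge0 _ (ltW g0))) -mulrA.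
rewrite ler_wpM2l ?exprn_ge0 ?(ltW g0)//.
rewrite -[leRHS]mul1r ler_pM// ?(ltW p0)//; apply: le_trans (fB _ _) _.
rewrite -mulrBl normrM (ger0_norm (ltW q0)) ler_wpM2l// ler_piMr//.
Qed.

(** Differentiating the term of index [n] in [z] produces a factor [beta ^- n.+1], which is what
    passing from [k] to [k.+1] supplies. *)
Lemma ser_taylor k N f f' B x y : 0 <= B ->
  (forall x y, `|f x - f y - f' y * (x - y)| <= B * (x - y) ^+ 2) ->
  `|ser k N f x - ser k N f y - ser k.+1 N f' y * (x - y)| <= B / (1 - g) * (x - y) ^+ 2.
Proof.
move=> B0 fB; rewrite mulr_suml -!sumrB mulrAC.
apply: (@geometric_sum_le _ (fun n => g ^+ n * beta ^- (k * n.+1) * f (x / beta ^+ n.+1) -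
  g ^+ n * beta ^- (k * n.+1) * f (y / beta ^+ n.+1) -
  g ^+ n * beta ^- (k.+1 * n.+1) * f' (y / beta ^+ n.+1) * (x - y))).
  by rewrite mulr_ge0// sqr_ge0.
move=> n; have /andP[p0 p1] := betaV_itv (k * n.+1); have /andP[q0 q1] := betaV_itv n.+1.
have -> : g ^+ n * beta ^- (k * n.+1) * f (x / beta ^+ n.+1) -
  g ^+ n * beta ^- (k * n.+1) * f (y / beta ^+ n.+1) -
  g ^+ n * beta ^- (k.+1 * n.+1) * f' (y / beta ^+ n.+1) * (x - y) =
  g ^+ n * beta ^- (k * n.+1) * (f (x / beta ^+ n.+1) - f (y / beta ^+ n.+1) -
    f' (y / beta ^+ n.+1) * (x / beta ^+ n.+1 - y / beta ^+ n.+1)).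
  by rewrite mulSn exprD invfM; ring.
rewrite normrM normrM (ger0_norm (ltW p0)) (ger0_norm (exprn_ge0 _ (ltW g0))) -mulrA.
rewrite ler_wpM2l ?exprn_ge0 ?(ltW g0)//.
rewrite -[leRHS]mul1r ler_pM// ?(ltW p0)//; apply: le_trans (fB _ _) _.
rewrite -mulrBl exprMn ler_wpM2l// ler_piMr// ?sqr_ge0//.
by rewrite expr2 -[leRHS]mulr1 ler_pM// ltW.
Qed.

End series.

(** * The correlation bound *)

Section correlation.
Context {R : realType} (b : nat) (g : R).
Hypothesis b2 : (2 <= b)%N.
Hypotheses (gb : (b%:R : R)^-1 < g) (g1 : g < 1).
Local Notation beta := (b%:R : R).
Variables f0 f1 f2 : R -> R.
Variables B c0 : R.
Hypothesis B1 : 1 <= B.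
Hypothesis f0_per : forall x (m : nat), f0 (x + m%:R) = f0 x.
Hypothesis f1_per : forall x (m : nat), f1 (x + m%:R) = f1 x.
Hypothesis f1_bound : forall x, `|f1 x| <= B.
Hypothesis f0_lip : forall x y, `|f0 x - f0 y| <= B * `|x - y|.
Hypothesis f1_lip : forall x y, `|f1 x - f1 y| <= B * `|x - y|.
Hypothesis f0_taylor : forall x y, `|f0 x - f0 y - f1 y * (x - y)| <= B * (x - y) ^+ 2.
Hypothesis f1_taylor : forall x y, `|f1 x - f1 y - f2 y * (x - y)| <= B * (x - y) ^+ 2.
Local Notation ser := (ser b g).

Definition pair_diff k N f (w v : nat) (x : R) :=
  ser k N f (x + w%:R) - ser k N f (x + v%:R).

Hypothesis c0_gt0 : 0 < c0.
Hypothesis nondegenerate : forall N (w v : nat) x, (0 < N)%N -> (w != v %[mod b])%N ->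
  c0 <= `|pair_diff 1 N f1 w v x| \/ c0 <= `|pair_diff 2 N f2 w v x|.

Definition close_pairs N (y r : R) : R :=
  \sum_(w < b ^ N) \sum_(v < b ^ N) (`|pair_diff 0 N f0 w v y| < r)%R%:R.

(** Left unnormalised: division by [beta ^+ (L + 2 * N)] gives the discretised T(r). *)
Definition correlation N L (r : R) : R :=
  \sum_(j < b ^ L) close_pairs N (j%:R / beta ^+ L) r.

Definition split_correlation N L (r : R) : R :=
  \sum_(j < b ^ L) \sum_(w < b ^ N) \sum_(v < b ^ N)
    ((w != v %[mod b])%N && (`|pair_diff 0 N f0 w v (j%:R / beta ^+ L)| < r)%R)%:R.

Let beta_gt0 := @beta_gt0 R b b2.
Let g0 : 0 < g.
Proof. by apply: lt_trans gb; rewrite invr_gt0. Qed.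

Lemma grid_step L (j w0 : nat) :
  (j%:R / beta ^+ L + w0%:R) / beta = (j + b ^ L * w0)%:R / beta ^+ L.+1.
Proof.
rewrite natrD natrM natrX exprSr invfM mulrA; congr (_ / _).
by rewrite mulrDl mulrAC betaXV// mul1r.
Qed.

Lemma mod_digits w0 w1 : ((w0 + b * w1) %% b = w0 %% b)%N.
Proof. by rewrite addnC mulnC modnMDl. Qed.

(** If the first digits agree, the first terms cancel and [g] times a difference with one digit less
    remains, at the point [(x + w0) / b]. As [x] runs through the grid of step [beta ^- L] and [w0]
    through the digits, these points run through the grid of step [beta ^- L.+1]. *)
Lemma correlation_step N L r :
  correlation N.+1 L r = correlation N L.+1 (r / g) + split_correlation N.+1 L r.
Proof.
rewrite /correlation expnSr (sum_digits _ _ (fun j => close_pairs N (j%:R / beta ^+ L.+1) (r / g))).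
rewrite -big_split/=; apply: eq_bigr => j _; rewrite /close_pairs.
pose F (w v : nat) := (w == v %[mod b])%N && (`|pair_diff 0 N.+1 f0 w v (j%:R / beta ^+ L)| < r)%R.
transitivity (\sum_(w < b ^ N.+1) \sum_(v < b ^ N.+1) (F w v)%:R +
  \sum_(w < b ^ N.+1) \sum_(v < b ^ N.+1)
    ((w != v %[mod b])%N && (`|pair_diff 0 N.+1 f0 w v (j%:R / beta ^+ L)| < r)%R)%:R :> R).
  rewrite -big_split/=; apply: eq_bigr => w _; rewrite -big_split/=; apply: eq_bigr => v _.
  by rewrite /F; case: eqP => _; rewrite ?addr0 ?add0r.
congr (_ + _); rewrite expnS (sum_digits _ _ (fun w => \sum_(v < b * b ^ N) (F w v)%:R)).
apply: eq_bigr => w0 _; apply: eq_bigr => w1 _.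
rewrite (sum_digits _ _ (fun v => (F _ v)%:R)) (bigD1 w0)//= [X in _ + X]big1 ?addr0; last first.
  move=> v0 vw; rewrite big1// => v1 _; rewrite /F !mod_digits/= !modn_small//.
  by rewrite eq_sym -val_eqE/= in vw; rewrite (negbTE vw).
apply: eq_bigr => v1 _; rewrite /F !mod_digits eqxx/=; congr (_%:R); congr nat_of_bool.
rewrite /pair_diff -add1n -{1 3}(expn1 b) !ser_digits//.
rewrite expr1 mul0n expr0 invr1 mulr1 !grid_step opprD addrACA subrr add0r -mulrBr.
by rewrite normrM gtr0_norm// ltr_pdivlMr// mulrC.
Qed.

Lemma close_pairs_ge0 N y r : 0 <= close_pairs N y r.
Proof. by apply: sumr_ge0 => w _; exact: sumr_ge0. Qed.

Lemma close_pairs_le N y r : close_pairs N y r <= beta ^+ (2 * N).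
Proof.
apply: (@le_trans _ _ (\sum_(w < b ^ N) \sum_(v < b ^ N) 1)).
  by apply: ler_sum => w _; apply: ler_sum => v _; rewrite lern1 leq_b1.
by rewrite !sumr_const !card_ord -mulrnA -natrX mulnC mulnn -expnM mulnC.
Qed.

Lemma correlation_le N L r : correlation N L r <= beta ^+ (L + 2 * N).
Proof.
apply: (@le_trans _ _ (\sum_(j < b ^ L) beta ^+ (2 * N))).
  by apply: ler_sum => j _; exact: close_pairs_le.
by rewrite sumr_const card_ord -[_ ^+ _ *+ _]mulr_natl natrX exprD.
Qed.

Let K := 2 * (B / (1 - g)).

Let KE : K = B / (1 - g) + B / (1 - g).
Proof. by rewrite /K mulr_natl mulr2n. Qed.

Let K1 : 1 <= K.
Proof. by rewrite /K mulrA ler_pdivlMr ?subr_gt0//; move: g0 B1; lra. Qed.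

Let B0 : 0 <= B. Proof. by apply: le_trans B1. Qed.

Lemma pair_diff1_bound N w v x : `|pair_diff 1 N f1 w v x| <= K.
Proof.
apply: le_trans (ler_normB _ _) _; rewrite KE.
by apply: lerD; exact: ser_bound.
Qed.

Lemma pair_diff1_lip N w v x y :
  `|pair_diff 1 N f1 w v x - pair_diff 1 N f1 w v y| <= K * `|x - y|.
Proof.
rewrite /pair_diff opprD addrACA -opprD; apply: le_trans (ler_normB _ _) _.
rewrite KE !mulrDl.
have e (u : nat) : x - y = (x + u%:R) - (y + u%:R) by ring.
by apply: lerD; [rewrite [in leRHS](e w)|rewrite [in leRHS](e v)]; exact: ser_lip.
Qed.

Lemma pair_diff_taylor k N f f' w v x y :
  (forall x y, `|f x - f y - f' y * (x - y)| <= B * (x - y) ^+ 2) ->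
  `|pair_diff k N f w v x - pair_diff k N f w v y - pair_diff k.+1 N f' w v y * (x - y)| <=
  K * (x - y) ^+ 2.
Proof.
move=> tf.
have t u := ser_taylor b2 g0 g1 k N (x + u%:R) (y + u%:R) B0 tf.
have e (u : nat) : (x + u%:R) - (y + u%:R) = x - y by ring.
have := t w; have := t v; rewrite !e => tv tw.
have -> : pair_diff k N f w v x - pair_diff k N f w v y - pair_diff k.+1 N f' w v y * (x - y) =
 (ser k N f (x + w%:R) - ser k N f (y + w%:R) - ser k.+1 N f' (y + w%:R) * (x - y)) -
 (ser k N f (x + v%:R) - ser k N f (y + v%:R) - ser k.+1 N f' (y + v%:R) * (x - y)).
  by rewrite /pair_diff; ring.
by apply: le_trans (ler_normB _ _) _; rewrite KE !mulrDl lerD.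
Qed.

Definition tangencies N q : R :=
  \sum_(a < b ^ q) \sum_(w < b ^ N) \sum_(v < b ^ N)
    ((w != v %[mod b])%N &&
     near_tangent b (pair_diff 0 N f0 w v) (pair_diff 1 N f1 w v) K q a)%:R.

Lemma tangencies_le_all N q : tangencies N q <= beta ^+ (q + 2 * N).
Proof.
apply: (@le_trans _ _ (\sum_(a < b ^ q) \sum_(w < b ^ N) \sum_(v < b ^ N) 1)).
  by apply: ler_sum => a _; apply: ler_sum => w _; apply: ler_sum => v _; rewrite lern1 leq_b1.
rewrite !sumr_const !card_ord -!mulrnA -!expnD -natrX ler_nat leq_pexp2l//; lia.
Qed.

Lemma split_correlation_le N L Q r :
  beta ^- L <= r -> beta ^- (2 * Q.+1) < r <= beta ^- (2 * Q) ->
  split_correlation N L r <=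
  \sum_(q < Q.+1) (3 * beta ^+ 2 * r * beta ^+ (q + L)) * tangencies N q.
Proof.
move=> Lr rQ; rewrite /split_correlation /tangencies.
under [leRHS]eq_bigr do rewrite exchange_big/= mulr_sumr.
rewrite [leRHS]exchange_big/= exchange_big/=; apply: ler_sum => w _.
under [leRHS]eq_bigr do rewrite exchange_big/= mulr_sumr.
rewrite [leRHS]exchange_big/= exchange_big/=; apply: ler_sum => v _.
case: (boolP (w != v %[mod b])%N) => wv/=; last first.
  rewrite big1// sumr_ge0// => q _; rewrite mulr_ge0 ?sumr_ge0//.
  have r0 : 0 <= r by apply: le_trans Lr; rewrite ltW// betaVX_gt0.
  by rewrite !mulr_ge0// ?exprn_ge0.
apply: level_sum => //; first exact: pair_diff1_lip.
- by move=> x y; exact: pair_diff_taylor.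
- exact: pair_diff1_bound.
Qed.

Lemma pair_diff_digits k n N f w0 w1 v0 v1 x : (forall x (m : nat), f (x + m%:R) = f x) ->
  pair_diff k (n + N) f (w0 + b ^ n * w1) (v0 + b ^ n * v1) x =
  pair_diff k n f w0 v0 x + g ^+ n * beta ^- (k * n) *
   (ser k N f ((x + w0%:R) / beta ^+ n + w1%:R) - ser k N f ((x + v0%:R) / beta ^+ n + v1%:R)).
Proof. by move=> fp; rewrite /pair_diff !ser_digits//; ring. Qed.

Let c1 := tangent_const b K.
(** The summand [K] pays for moving the base points of two tails, [K / 2] each; the summand 1 makes
    the inequality strict. *)
Let c2 := c1 + K + 1.

(** The digits after the [n]-th change the derivative by at most [K * (g / beta) ^+ n], so near
    tangency forces the derivative of the first [n] terms to be small, whence the indicator. Divided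
    by [g ^+ n], the condition on the values places the difference of the two tails within
    [O(beta ^- n)] of a constant. As [x] is in [0, 1], replacing it by 0 in the tails costs no more,
    and [near_pairs_le] separates [w0] from [v0]. *)
Lemma near_tangent_pairs n N q w0 v0 a : (0 < n)%N -> (a < b ^ q)%N ->
  beta ^- (2 * q) <= (g / beta) ^+ n -> (g / beta) ^+ n <= beta / g * beta ^- q ->
  \sum_(w1 < b ^ N) \sum_(v1 < b ^ N) (near_tangent b
     (pair_diff 0 (n + N) f0 (w0 + b ^ n * w1) (v0 + b ^ n * v1))
     (pair_diff 1 (n + N) f1 (w0 + b ^ n * w1) (v0 + b ^ n * v1)) K q a)%:R <=
  (`|pair_diff 1 n f1 w0 v0 (a%:R / beta ^+ q)| <= (c1 + K * (beta / g)) * beta ^- q)%R%:R *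
  (3 / 2 * (close_pairs N (w0%:R / beta ^+ n) (c2 * beta ^- n) +
            close_pairs N (v0%:R / beta ^+ n) (c2 * beta ^- n))).
Proof.
move=> n0 aq qn nq; set x := a%:R / beta ^+ q.
have x0 : 0 <= x by rewrite divr_ge0// exprn_ge0.
have x1 : x <= 1 by rewrite ler_pdivrMr ?betaX_gt0// mul1r -natrX ler_nat ltnW.
have bn0 : 0 < beta ^+ n by rewrite betaX_gt0.
have bV0 : 0 < beta ^- n by rewrite invr_gt0.
have gn0 : 0 < g ^+ n by rewrite exprn_gt0.
have c10 : 0 < c1 by rewrite /c1 /tangent_const ltr_pwDl// mulr_ge0// ?(le_trans _ K1)// addr_ge0 ?mulr_ge0.
have rn : (g / beta) ^+ n = g ^+ n * beta ^- n by rewrite exprMn exprVn.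
case: (boolP (`|pair_diff 1 n f1 w0 v0 x| <= _)) => [_|hn]; last first.
  rewrite mul0r big1// => w1 _; rewrite big1// => v1 _.
  apply/eqP; rewrite pnatr_eq0 eqb0; apply: contra hn => /andP[_].
  rewrite -/x pair_diff_digits// mul1n -rn; set D := _ - _ => h.
  have DK : `|D| <= K.
    apply: le_trans (ler_normB _ _) _; rewrite KE.
    by apply: lerD; exact: ser_bound.
  have -> : pair_diff 1 n f1 w0 v0 x = pair_diff 1 n f1 w0 v0 x + (g / beta) ^+ n * D
    - (g / beta) ^+ n * D by rewrite addrK.
  apply: le_trans (ler_normB _ _) _; rewrite mulrDl lerD// normrM.
  rewrite ger0_norm ?exprn_ge0 ?divr_ge0 ?(ltW g0)// mulrC -mulrA.
  by rewrite ler_pM// exprn_ge0// divr_ge0// ltW.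
rewrite mul1r.
pose u (y : nat) (i : nat) := ser 0 N f0 (y%:R / beta ^+ n + i%:R).
have := @near_pairs_le R (b ^ N) (u w0) (u v0) (pair_diff 0 n f0 w0 v0 x / g ^+ n) (c2 * beta ^- n).
have c2n : 0 < c2 * beta ^- n by rewrite mulr_gt0// /c2; move: c10 K1; lra.
move=> /(_ c2n); apply: le_trans; apply: ler_sum => w1 _; apply: ler_sum => v1 _.
rewrite ler_nat; case: (boolP (near_tangent _ _ _ _ _ _)) => //= /andP[+ _].
rewrite -/x pair_diff_digits// mul0n expr0 invr1 mulr1 -/c1 => h0.
rewrite lt0b.
have lip (y i : nat) : `|ser 0 N f0 ((x + y%:R) / beta ^+ n + i%:R) - u y i| <= K / 2 * beta ^- n.
  apply: le_trans (ser_lip b2 g0 g1 0 N _ _ B0 f0_lip) _.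
  have -> : (x + y%:R) / beta ^+ n + i%:R - (y%:R / beta ^+ n + i%:R) = x * beta ^- n.
    by rewrite mulrDl; ring.
  have -> : K / 2 = B / (1 - g) by rewrite /K; field; rewrite subr_eq0 gt_eqF.
  rewrite ler_wpM2l ?divr_ge0 ?subr_ge0 ?(ltW g1)//.
  by rewrite normrM ger0_norm// (ger0_norm (ltW bV0)) ler_piMl// ltW.
have lw := lip w0 w1; have lv := lip v0 v1.
move: h0 lw lv; set P := pair_diff _ _ _ _ _ _; set X := ser _ _ _ _; set Y := ser _ _ _ _.
move=> h0 lw lv.
have -> : P / g ^+ n + (u w0 w1 - u v0 v1) =
   (P + g ^+ n * (X - Y)) / g ^+ n - (X - u w0 w1) + (Y - u v0 v1).
  by field; rewrite gt_eqF.
have h1 : `|(P + g ^+ n * (X - Y)) / g ^+ n| <= c1 * beta ^- n.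
  rewrite normrM normfV (ger0_norm (ltW gn0)) ler_pdivrMr//.
  by apply: le_trans h0 _; rewrite -mulrA ler_wpM2l ?(ltW c10)// (le_trans qn)// rn mulrC.
apply: le_lt_trans (ler_normD _ _) _; apply: (@le_lt_trans _ _ (c1 * beta ^- n + K / 2 * beta ^- n + K / 2 * beta ^- n)).
  by apply: lerD lv; apply: le_trans (ler_normB _ _) _; exact: lerD.
by rewrite /c2; move: bV0; lra.
Qed.

Lemma betaV_small (e : R) : 0 < e -> exists p, beta ^- p < e.
Proof.
move=> e0; have bV : 0 < beta^-1 < 1 by rewrite invr_gt0 beta_gt0 invf_lt1// ltr1n.
by have [p hp] := expr_small bV e0; exists p; rewrite -exprVn.
Qed.

(** For fixed [w0] and [v0] with different first digits, [critical_count] admits boundedly many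
    windows [a], uniformly in [q]. The points [w0 / b ^ n] form the grid of step [beta ^- n], so
    summing [cp w0] gives a correlation; the other word is free and contributes [beta ^+ n]. *)
Lemma tangencies_le : exists2 C, 0 <= C & forall n N q, (0 < n)%N ->
  beta ^- (2 * q) <= (g / beta) ^+ n -> (g / beta) ^+ n <= beta / g * beta ^- q ->
  tangencies (n + N) q <= C * beta ^+ n * correlation N n (c2 * beta ^- n).
Proof.
pose C := c1 + K * (beta / g).
have K0 : 0 <= K by apply: le_trans K1.
have c10 : 0 < c1 by rewrite /c1 /tangent_const ltr_pwDl// mulr_ge0// addr_ge0 ?mulr_ge0.
have C0 : 0 < C by rewrite ltr_pwDl// mulr_ge0// divr_ge0// ltW.
(* A single window scale for both smallness conditions of [critical_count]. *)
have [p hp] : exists p, beta ^- p < c0 / (2 * (K + C)).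
  by apply: betaV_small; rewrite divr_gt0// mulr_gt0// ltr_wpDl.
have KC0 : 0 < K + C by rewrite ltr_wpDl.
have hp' : (K + C) * beta ^- p < c0 / 2.
  rewrite -ltr_pdivlMl//; apply: lt_le_trans hp _.
  by rewrite invfM (_ : _ * _ = (K + C)^-1 * (c0 / 2))//; ring.
have Cp : C * beta ^- p < c0.
  have : 0 <= K * beta ^- p by rewrite mulr_ge0// ltW// betaVX_gt0.
  by move: hp' c0_gt0; rewrite mulrDl; lra.
have Kp : K * beta ^- p <= c0 / 2.
  have : 0 <= C * beta ^- p by rewrite mulr_ge0 ?(ltW C0)// ltW// betaVX_gt0.
  by move: hp'; rewrite mulrDl; lra.
pose D := beta ^+ p * (4 * C / c0 + 1).
have D0 : 0 <= D.
  by rewrite /D mulr_ge0 ?exprn_ge0// addr_ge0// divr_ge0 ?mulr_ge0 ?(ltW C0)// ltW.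
exists (3 * D); first by rewrite mulr_ge0.
move=> n N q n0 qn nq.
pose cp (w0 : nat) := close_pairs N (w0%:R / beta ^+ n) (c2 * beta ^- n).
pose near w0 v0 a := (`|pair_diff 1 n f1 w0 v0 (a%:R / beta ^+ q)| <= C * beta ^- q)%R.
have cp0 w0 : 0 <= cp w0 by exact: close_pairs_ge0.
apply: (@le_trans _ _ (\sum_(a < b ^ q) \sum_(w0 < b ^ n) \sum_(v0 < b ^ n)
   (w0 != v0 %[mod b])%N%:R * ((near w0 v0 a)%:R * (3 / 2 * (cp w0 + cp v0))))).
  apply: ler_sum => a _.
  rewrite expnD (sum_digits _ _ (fun w => \sum_(v < b ^ n * b ^ N) ((w != v %[mod b])%N &&
     near_tangent b (pair_diff 0 (n + N) f0 w v) (pair_diff 1 (n + N) f1 w v) K q a)%:R)).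
  apply: ler_sum => w0 _.
  under eq_bigr => w1 _ do rewrite (sum_digits _ _ (fun v => ((w0 + b ^ n * w1 != v %[mod b])%N &&
     near_tangent b (pair_diff 0 (n + N) f0 (w0 + b ^ n * w1) v)
       (pair_diff 1 (n + N) f1 (w0 + b ^ n * w1) v) K q a)%:R)).
  rewrite exchange_big/=; apply: ler_sum => v0 _.
  have md (y y1 : nat) : ((y + b ^ n * y1) %% b = y %% b)%N.
    by rewrite -(prednK n0) expnS -mulnA mod_digits.
  under eq_bigr => w1 _ do under eq_bigr => v1 _ do rewrite !md.
  case: (boolP (w0 != v0 %[mod b])%N) => wv /=; last by rewrite mul0r big1// => w1 _; rewrite big1.
  by rewrite mul1r; exact: near_tangent_pairs.
rewrite exchange_big/=.
apply: (@le_trans _ _ (\sum_(w0 < b ^ n) \sum_(v0 < b ^ n) D * (3 / 2 * (cp w0 + cp v0)))).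
  apply: ler_sum => w0 _; rewrite exchange_big/=; apply: ler_sum => v0 _.
  have X0 : 0 <= 3 / 2 * (cp w0 + cp v0) by rewrite mulr_ge0 ?divr_ge0// addr_ge0.
  rewrite -mulr_sumr -mulr_suml.
  case: (boolP (w0 != v0 %[mod b])%N) => wv; last by rewrite mul0r mulr_ge0.
  rewrite mul1r ler_wpM2r//.
  apply: (@critical_count R b b2 _ (pair_diff 2 n f2 w0 v0) K c0 C) => //; first exact: ltW.
  - by move=> x y; exact: pair_diff_taylor.
  - by move=> x; exact: nondegenerate.
have -> : \sum_(w0 < b ^ n) \sum_(v0 < b ^ n) D * (3 / 2 * (cp w0 + cp v0)) =
  D * (3 / 2 * (\sum_(w0 < b ^ n) \sum_(v0 < b ^ n) cp w0 +
                \sum_(w0 < b ^ n) \sum_(v0 < b ^ n) cp v0)).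
  rewrite -big_split/= !mulr_sumr; apply: eq_bigr => w0 _.
  by rewrite -big_split/= !mulr_sumr.
rewrite exchange_big/= sumr_const card_ord -/(correlation N n (c2 * beta ^- n)).
by rewrite -[_ *+ (b ^ n)]mulr_natl natrX le_eqVlt; apply/orP; left; apply/eqP; field.
Qed.

(** The ratio of the geometric series that dominates the [b^(q - n(q))]; it is less than 1 exactly
    because [gamma > 1 / b]. *)
Let s := Num.sqrt ((beta * g)^-1).

Let bg1 : 1 < beta * g.
Proof. by rewrite -ltr_pdivrMl// mulr1. Qed.

Let s_itv : 0 < s < 1.
Proof.
have bg0 : 0 < beta * g := lt_trans ltr01 bg1.
by rewrite /s sqrtr_gt0 invr_gt0 bg0/= -[ltRHS]sqrtr1 ltr_sqrt// invf_lt1.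
Qed.

(* This is where [gamma > 1 / b] enters: the scale [n] paired with [q] satisfies
   [n >= kappa q] for some [kappa > 1]. *)
Lemma dual_scale q : exists n, [/\ (q <= n)%N, beta ^- (2 * q) <= (g / beta) ^+ n,
  (g / beta) ^+ n <= beta / g * beta ^- q & beta ^+ q * beta ^- n <= beta / g * s ^+ q].
Proof.
have bb := beta_ge2 (R := R) b2.
have rho0 : 0 < g / beta by rewrite divr_gt0.
have rho1 : g / beta < 1 by rewrite ltr_pdivrMr// mul1r; move: bb g1; lra.
have bq1 m : beta ^- m <= 1 by rewrite invf_le1 ?betaX_gt0// betaX_ge1.
(* The largest [n] with [(g / beta) ^+ n >= beta ^- (2 * q)]. It is at least [q] because
   [g / beta > beta ^- 2]. *)
have [n /andP[n1 n2]] : exists n, (g / beta) ^+ n.+1 < beta ^- (2 * q) <= (g / beta) ^+ n.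
  by apply: exp_floor; rewrite ?rho0// betaVX_gt0//=.
have qn : (q <= n)%N.
  rewrite leqNgt; apply/negP => nq.
  have : (g / beta) ^+ q <= (g / beta) ^+ n.+1 by rewrite ler_wiXn2l// ltW.
  move=> /le_lt_trans/(_ n1); rewrite exprM -exprVn ltNge => /negP; apply.
  rewrite ler_pXn2r ?nnegrE ?invr_ge0 ?exprn_ge0 ?(ltW rho0) ?(leq_ltn_trans _ nq)//.
  by rewrite expr2 invfM ler_pM2r ?invr_gt0// ltW.
have bg0 : 1 <= beta / g by rewrite ler_pdivlMr// mul1r; move: bb g1; lra.
exists n; split => //.
  have : (g / beta) ^+ n < beta / g * beta ^- (2 * q).
    by rewrite -[beta / g]invrK invf_div -ltr_pdivrMl ?invr_gt0// invrK -exprS.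
  move=> /ltW /le_trans; apply; rewrite ler_wpM2l ?(le_trans _ bg0)//.
  by rewrite ler_betaVX// leq_pmull.
(* Squares are compared: [beta ^+ (2 * q) < (beta / g) ^+ n.+1] bounds the left side by
   [beta / g * (beta * g) ^- n], and [q <= n] with [beta * g > 1] does the rest. *)
rewrite -(@ler_pXn2r _ 2) ?nnegrE ?mulr_ge0 ?exprn_ge0 ?invr_ge0 ?exprn_ge0 ?sqrtr_ge0 ?(ltW g0)//.
have e1 : (beta ^+ q * beta ^- n) ^+ 2 = beta ^+ (2 * q) * beta ^- (2 * n).
  by rewrite exprMn -exprM mulnC -exprVn -exprM exprVn [(n * 2)%N]mulnC.
have e2 : (beta / g * s ^+ q) ^+ 2 = (beta / g) ^+ 2 * (beta * g) ^- q.
  by rewrite exprMn -exprM mulnC exprM sqr_sqrtr ?exprVn// invr_ge0 mulr_ge0// ltW.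
rewrite e1 e2.
have h : beta ^+ (2 * q) < (beta / g) ^+ n.+1.
  by rewrite -ltf_pV2 ?posrE ?betaX_gt0 ?exprn_gt0 ?divr_gt0// -exprVn invf_div.
apply: (@le_trans _ _ ((beta / g) ^+ n.+1 * beta ^- (2 * n))).
  by rewrite ler_wpM2r ?(ltW (betaVX_gt0 _ _))// ltW.
have -> : (beta / g) ^+ n.+1 * beta ^- (2 * n) = beta / g * (beta * g) ^- n.
  rewrite exprS -mulrA; congr (_ * _).
  rewrite exprM -!exprVn -exprMn; congr (_ ^+ _).
  field.
  by rewrite !gt_eqF.
apply: ler_pM; rewrite ?divr_ge0 ?invr_ge0 ?exprn_ge0 ?mulr_ge0 ?(ltW g0)//.
  by rewrite expr2 ler_peMl// (le_trans _ bg0).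
by rewrite lef_pV2 ?posrE ?exprn_gt0 ?mulr_gt0// ler_eXn2l.
Qed.

Lemma geometric_tail_le m q0 : \sum_(q < m) (q0 <= q)%N%:R * s ^+ q <= s ^+ q0 / (1 - s).
Proof.
have /andP[s0 s1] := s_itv.
suff h : (1 - s) * \sum_(q < m) (q0 <= q)%N%:R * s ^+ q <= s ^+ q0 - s ^+ (maxn q0 m).
  rewrite ler_pdivlMr ?subr_gt0// mulrC (le_trans h)// gerBl exprn_ge0// ltW//.
elim: m => [|m IH]; first by rewrite big_ord0 mulr0 subr_ge0 maxn0.
rewrite big_ord_recr/= mulrDr; case: (leqP q0 m) => qm; last first.
  by rewrite mul0r mulr0 addr0 (le_trans IH)// (maxn_idPl (ltnW qm)) (maxn_idPl qm).
rewrite (maxn_idPr qm) in IH; rewrite (maxn_idPr (leqW qm)) mul1r exprS; lra.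
Qed.

Lemma geometric_small (e : R) : 0 < e -> exists2 q0, (0 < q0)%N & s ^+ q0 / (1 - s) <= e.
Proof.
move=> e0; have /andP[s0 s1] := s_itv.
have d0 : 0 < e * (1 - s) by rewrite mulr_gt0// subr_gt0.
have [n hn] := expr_small s_itv d0.
exists n.+1 => //; rewrite ler_pdivrMr ?subr_gt0// exprS (le_trans _ (ltW hn))//.
by rewrite ler_piMl ?exprn_ge0 ?(ltW s0) ?(ltW s1).
Qed.

(** Strong induction on [N]. The two conditions keep the truncation error and the grid step of order
    at most [r]. Equal first digits reproduce the bound with factor [(beta * g)^-1 < 1]; different
    ones are sorted by the scale [q] of the derivative, and all but finitely many scales go back to
    the induction hypothesis. *)
Theorem correlation_bound : exists2 C, 0 < C & forall N L r,
  g ^+ N <= r -> beta ^- L <= r -> correlation N L r <= C * r * beta ^+ (L + 2 * N).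
Proof.
have [C3 C30 tang] := tangencies_le.
have bb := beta_ge2 (R := R) b2.
have c20 : 1 <= c2.
  rewrite /c2 lerDr addr_ge0// ?(le_trans _ K1)// /c1 /tangent_const.
  by rewrite addr_ge0// mulr_ge0// ?(le_trans _ K1)// addr_ge0// mulr_ge0.
have c2p : 0 < c2 by apply: lt_le_trans c20.
(* The share of the bound that equal first digits leave available. *)
pose d := 1 - (beta * g)^-1.
have d0 : 0 < d by rewrite subr_gt0 invf_lt1// (lt_trans ltr01 bg1).
pose M := beta / g.
have M0 : 0 < M by rewrite divr_gt0.
pose C4 := 3 * beta ^+ 2 * C3 * c2 * M.
have C40 : 0 <= C4 by rewrite /C4 mulr_ge0 ?(ltW M0)// mulr_ge0 ?(ltW c2p)// mulr_ge0// mulr_ge0 ?exprn_ge0.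
have [q0 q00 small] : exists2 q0, (0 < q0)%N & s ^+ q0 / (1 - s) <= d / (2 * (C4 + 1)).
  by apply: geometric_small; rewrite divr_gt0// mulr_gt0// ltr_wpDl.
pose A := 3 * beta ^+ 2 * beta ^+ (2 * q0) * q0%:R.
have A0 : 0 <= A by rewrite !mulr_ge0 ?exprn_ge0.
(* Chosen so that [(1 - d) * C + A + C * (d / 2) <= C]; here [A] comes from the scales below [q0]
   and does not involve [C]. *)
pose C := 1 + 2 * A / d.
have C1 : 1 <= C by rewrite lerDl divr_ge0 ?mulr_ge0// ltW.
have C0 : 0 < C by apply: lt_le_trans C1.
exists C => //; elim/ltn_ind => N IH L r gr Lr.
have r0 : 0 < r by apply: lt_le_trans Lr; rewrite betaVX_gt0.
have X0 : 0 < r * beta ^+ (L + 2 * N) by rewrite mulr_gt0 ?betaX_gt0.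
have [r1|r1] := leP 1 r.
  apply: le_trans (correlation_le _ _ _) _; rewrite ler_peMl ?exprn_ge0//.
  by rewrite -[1]mulr1 ler_pM.
(* [N = 0] would give [1 <= r], a case already settled. *)
case: N IH gr X0 => [|N] IH gr X0; first by rewrite expr0 leNgt r1 in gr.
have [Q rQ] : exists Q, beta ^- (2 * Q.+1) < r <= beta ^- (2 * Q).
  have [Q hQ] : exists Q, (beta ^- 2) ^+ Q.+1 < r <= (beta ^- 2) ^+ Q.
    apply: exp_floor; last by rewrite r0 ltW.
    by rewrite betaVX_gt0// invf_lt1 ?betaX_gt0// exprn_egt1// ltr1n.
  by exists Q; rewrite !exprVn -!exprM in hQ.
have /andP[Qr rQ'] := rQ.
rewrite correlation_step.
have h1 : correlation N L.+1 (r / g) <= (beta * g)^-1 * C * (r * beta ^+ (L + 2 * N.+1)).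
  have rg : r <= r / g by rewrite ler_pdivlMr// ler_piMr// ltW.
  have grg : g ^+ N <= r / g by rewrite ler_pdivlMr// -exprSr.
  have Lrg : beta ^- L.+1 <= r / g.
    by apply: le_trans (le_trans Lr rg); rewrite ler_betaVX.
  apply: le_trans (IH N (ltnSn N) L.+1 (r / g) grg Lrg) _.
  have -> : beta ^+ (L + 2 * N.+1) = beta * beta ^+ (L.+1 + 2 * N).
    by rewrite -exprS; congr (_ ^+ _); clear; lia.
  move: (beta ^+ (L.+1 + 2 * N)) => Z.
  rewrite le_eqVlt; apply/orP; left; apply/eqP; move: (C) => {}C'; field.
  by rewrite !gt_eqF.
have h2 : split_correlation N.+1 L r <=
    (A + C * (C4 * (s ^+ q0 / (1 - s)))) * (r * beta ^+ (L + 2 * N.+1)).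
  apply: le_trans (split_correlation_le _ Lr rQ) _.
  (* Scales below [q0] get the trivial bound on tangencies, their indicator having the shape that
     [sum_interval] counts; the others get a geometric tail. *)
  apply: (@le_trans _ _ (\sum_(q < Q.+1) ((0 <= q)%N && (q < 0 + q0)%N)%:R * (3 * beta ^+ 2 * beta ^+ (2 * q0)) * (r * beta ^+ (L + 2 * N.+1)) +
     \sum_(q < Q.+1) C * (C4 * ((q0 <= q)%N%:R * s ^+ q)) * (r * beta ^+ (L + 2 * N.+1)))); last first.
    rewrite [leRHS]mulrDl; apply: lerD; rewrite -mulr_suml.
      rewrite -mulr_suml ler_wpM2r ?(ltW X0)// /A mulrC ler_wpM2l ?mulr_ge0 ?exprn_ge0//.
      rewrite -natr_sum ler_nat (leq_trans (sum_interval _ _ _))// geq_minr//.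
    rewrite -!mulr_sumr ler_wpM2r ?(ltW X0)// ler_wpM2l ?(ltW C0)// ler_wpM2l//.
    exact: geometric_tail_le.
  rewrite -big_split/=; apply: ler_sum => -[q /= qQ] _; rewrite ltnS in qQ.
  rewrite add0n; case: (ltnP q q0) => qq0.
    rewrite !mul0r !mulr0 !mul0r addr0 mul1r.
    apply: (@le_trans _ _ (3 * beta ^+ 2 * r * beta ^+ (q + L) * beta ^+ (q + 2 * N.+1))).
      by rewrite ler_wpM2l ?tangencies_le_all// !mulr_ge0 ?exprn_ge0// ltW.
    have -> : 3 * beta ^+ 2 * r * beta ^+ (q + L) * beta ^+ (q + 2 * N.+1) =
      3 * beta ^+ 2 * beta ^+ (2 * q) * (r * beta ^+ (L + 2 * N.+1)).
      have e : beta ^+ (q + L) * beta ^+ (q + 2 * N.+1) = beta ^+ (2 * q) * beta ^+ (L + 2 * N.+1).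
        by rewrite -!exprD; congr (_ ^+ _); clear; lia.
      by rewrite -mulrA e; ring.
    rewrite ler_wpM2r ?(ltW X0)// ler_wpM2l ?mulr_ge0 ?exprn_ge0//.
    by rewrite ler_betaX// leq_mul2l ltnW.
  rewrite !mul0r add0r mul1r.
  have [n [qn n1 n2 n3]] := dual_scale q.
  have n0 : (0 < n)%N by rewrite (leq_trans _ qn)// (leq_trans q00).
  have rn : r <= (g / beta) ^+ n.
    apply: le_trans n1; apply: le_trans rQ' _.
    by rewrite ler_betaVX// leq_mul2l.
  have gN : g ^+ N.+1 <= g ^+ n * beta ^- n by rewrite (le_trans gr)// -exprVn -exprMn.
  (* There are enough digits to remove [n] of them, because [g ^+ N.+1 <= r <= (g / beta) ^+ n]. The
     same chain gives [g ^+ (N.+1 - n) <= beta ^- n], the truncation condition at the new radius. *)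
  have nN : (n <= N.+1)%N.
    rewrite leqNgt; apply/negP => Nn.
    have : g ^+ n <= g ^+ N.+1 by rewrite ler_wiXn2l ?ltW// (ltnW Nn).
    move=> /le_trans/(_ gN); rewrite -[leLHS]mulr1 ler_pM2l ?exprn_gt0// leNgt => /negP; apply.
    by rewrite invf_lt1 ?betaX_gt0// -[ltLHS](expr0 beta) ltr_eXn2l ?ltr1n.
  have gNn : g ^+ (N.+1 - n) <= beta ^- n.
    by rewrite -(ler_pM2l (_ : 0 < g ^+ n)) ?exprn_gt0// -exprD subnKC.
  have cn : beta ^- n <= c2 * beta ^- n by rewrite ler_peMl ?(ltW (betaVX_gt0 _ _)).
  have ltn : (N.+1 - n < N.+1)%N by rewrite ltn_subrL n0.
  have IHn := IH _ ltn n (c2 * beta ^- n) (le_trans gNn cn) cn.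
  have := tang n (N.+1 - n)%N q n0 n1 n2; rewrite subnKC// => tq.
  have tq' : tangencies N.+1 q <= C3 * c2 * C * (beta ^+ (2 * N.+1) * beta ^- n).
    apply: le_trans tq _.
    apply: (@le_trans _ _ (C3 * beta ^+ n * (C * (c2 * beta ^- n) * beta ^+ (n + 2 * (N.+1 - n))))).
      by rewrite ler_wpM2l// mulr_ge0 ?exprn_ge0.
    have e : beta ^+ (2 * N.+1) = beta ^+ n * beta ^+ (n + 2 * (N.+1 - n)).
      by rewrite -exprD; congr (_ ^+ _); clear -nN; lia.
    by rewrite e le_eqVlt; apply/orP; left; apply/eqP; ring.
  apply: (@le_trans _ _ (3 * beta ^+ 2 * r * beta ^+ (q + L) * (C3 * c2 * C * (beta ^+ (2 * N.+1) * beta ^- n)))).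
    by rewrite ler_wpM2l// !mulr_ge0 ?exprn_ge0// ltW.
  have -> : 3 * beta ^+ 2 * r * beta ^+ (q + L) * (C3 * c2 * C * (beta ^+ (2 * N.+1) * beta ^- n)) =
    3 * beta ^+ 2 * C3 * c2 * C * (r * beta ^+ (L + 2 * N.+1)) * (beta ^+ q * beta ^- n).
    by rewrite !exprD; ring.
  have -> : C * (C4 * s ^+ q) * (r * beta ^+ (L + 2 * N.+1)) =
    3 * beta ^+ 2 * C3 * c2 * C * (r * beta ^+ (L + 2 * N.+1)) * (M * s ^+ q).
    by rewrite /C4; ring.
  by rewrite ler_wpM2l// !mulr_ge0 ?exprn_ge0// ltW.
apply: le_trans (lerD h1 h2) _; rewrite -mulrDl -mulrA ler_wpM2r ?(ltW X0)//.
have h3 : C4 * (s ^+ q0 / (1 - s)) <= d / 2.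
  apply: (@le_trans _ _ ((C4 + 1) * (d / (2 * (C4 + 1))))).
    apply: ler_pM => //; last by rewrite lerDl.
    by have /andP[s0 s1] := s_itv; rewrite divr_ge0 ?exprn_ge0 ?subr_ge0 ?(ltW s0) ?(ltW s1).
  by rewrite le_eqVlt; apply/orP; left; apply/eqP; field; rewrite gt_eqF// ltr_wpDl.
have h4 : C * (C4 * (s ^+ q0 / (1 - s))) <= C * (d / 2) by rewrite ler_wpM2l// ltW.
have h5 : C * d = d + 2 * A by rewrite /C mulrDl mul1r divfK// gt_eqF.
have h6 : (beta * g)^-1 = 1 - d by rewrite /d; ring.
rewrite h6; move: h4 h5 d0 A0; lra.
Qed.

End correlation.

(** * Nondegeneracy for the sine *)

Section sine.
Context {R : realType} (b : nat) (g : R).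
Hypothesis b2 : (2 <= b)%N.
Hypotheses (gb : (b%:R : R)^-1 < g) (g1 : g < 1).
Local Notation beta := (b%:R : R).
Let p : R := 2 * pi.

(** [psi1] and [psi2] are the first and second derivatives of [psi]. *)
Definition psi1 (x : R) : R := - (2 * pi) ^+ 2 * cos (2 * pi * x).
Definition psi2 (x : R) : R := (2 * pi) ^+ 3 * sin (2 * pi * x).

Let p1 : 1 <= p.
Proof. by have := pi_ge2 R; rewrite /p; lra. Qed.
Let p0 : 0 <= p. Proof. exact: le_trans p1. Qed.
Let pX n : 0 <= p ^+ n. Proof. exact: exprn_ge0. Qed.

Lemma sin_periodic (m : nat) (x : R) : sin (p * (x + m%:R)) = sin (p * x).
Proof.
have -> : p * (x + m%:R) = p * x + (pi *+ 2) *+ m by rewrite -[_ *+ m in RHS]mulr_natr mulr2n /p; ring.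
by rewrite (periodicn (@sinD2pi R)).
Qed.
Lemma cos_periodic (m : nat) (x : R) : cos (p * (x + m%:R)) = cos (p * x).
Proof.
have -> : p * (x + m%:R) = p * x + (pi *+ 2) *+ m by rewrite -[_ *+ m in RHS]mulr_natr mulr2n /p; ring.
by rewrite (periodicn (@cosD2pi R)).
Qed.
Lemma psi_periodic x (m : nat) : psi (x + m%:R) = psi x :> R.
Proof. by rewrite /psi sin_periodic. Qed.
Lemma psi1_periodic x (m : nat) : psi1 (x + m%:R) = psi1 x.
Proof. by rewrite /psi1 cos_periodic. Qed.

Let p_le4 n : (n <= 4)%N -> p ^+ n <= p ^+ 4.
Proof. by move=> n4; rewrite ler_weXn2l. Qed.

Lemma psi_bound x : `|psi x| <= p ^+ 4 :> R.
Proof.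
rewrite /psi -/p normrM normrN (ger0_norm p0); apply: le_trans (p_le4 (isT : 1 <= 4)%N).
by rewrite expr1 ler_piMr// sin_max.
Qed.
Lemma psi1_bound x : `|psi1 x| <= p ^+ 2.
Proof.
by rewrite /psi1 -/p normrM normrN (ger0_norm (pX 2)) ler_piMr// cos_max.
Qed.
Lemma psi2_bound x : `|psi2 x| <= p ^+ 3.
Proof. by rewrite /psi2 -/p normrM (ger0_norm (pX 3)) ler_piMr// sin_max. Qed.

Lemma psi_lip x y : `|psi x - psi y| <= p ^+ 4 * `|x - y| :> R.
Proof.
rewrite /psi -/p -mulrBr normrM normrN (ger0_norm p0).
apply: (@le_trans _ _ (p ^+ 2 * `|x - y|)); last by rewrite ler_wpM2r// p_le4.
rewrite expr2 -mulrA ler_wpM2l//; apply: le_trans (sin_lip _ _) _.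
by rewrite -mulrBr normrM (ger0_norm p0).
Qed.
Lemma psi1_lip x y : `|psi1 x - psi1 y| <= p ^+ 4 * `|x - y|.
Proof.
rewrite /psi1 -/p -mulrBr normrM normrN (ger0_norm (pX 2)).
apply: (@le_trans _ _ (p ^+ 3 * `|x - y|)); last by rewrite ler_wpM2r// p_le4.
rewrite [p ^+ 3]exprSr -mulrA ler_wpM2l//; apply: le_trans (cos_lip _ _) _.
by rewrite -mulrBr normrM (ger0_norm p0).
Qed.
Lemma psi_taylor x y : `|psi x - psi y - psi1 y * (x - y)| <= p ^+ 4 * (x - y) ^+ 2.
Proof.
rewrite /psi /psi1 -/p.
have -> : - p * sin (p * x) - - p * sin (p * y) - - p ^+ 2 * cos (p * y) * (x - y) =
  - p * (sin (p * x) - sin (p * y) - cos (p * y) * (p * x - p * y)) by ring.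
rewrite normrM normrN (ger0_norm p0).
apply: (@le_trans _ _ (p ^+ 3 * (x - y) ^+ 2)); last by rewrite ler_wpM2r ?sqr_ge0// p_le4.
rewrite [p ^+ 3]exprS -mulrA ler_wpM2l//; apply: le_trans (sin_taylor _ _) _.
by rewrite -mulrBr exprMn.
Qed.
Lemma psi1_taylor x y : `|psi1 x - psi1 y - psi2 y * (x - y)| <= p ^+ 4 * (x - y) ^+ 2.
Proof.
rewrite /psi1 /psi2 -/p.
have -> : - p ^+ 2 * cos (p * x) - - p ^+ 2 * cos (p * y) - p ^+ 3 * sin (p * y) * (x - y) =
  - p ^+ 2 * (cos (p * x) - cos (p * y) + sin (p * y) * (p * x - p * y)) by ring.
rewrite normrM normrN (ger0_norm (pX 2)).
rewrite (exprD p 2 2) -mulrA ler_wpM2l//; apply: le_trans (cos_taylor _ _) _.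
by rewrite -mulrBr exprMn.
Qed.

Lemma sin_addnpi (x : R) n : `|sin (x + pi *+ n)| = `|sin x|.
Proof.
elim: n => [|n IH]; first by rewrite mulr0n addr0.
by rewrite mulrSr addrA (sinDpi (x + pi *+ n)) normrN.
Qed.

(** Up to sign the sine depends only on the residue [r] of the difference modulo [b], and
    [0 < r < b]. Jordan's inequality applies at [pi * r / b] or at its reflection
    [pi * (b - r) / b]. *)
Lemma sin_digits_ge (w v : nat) : (w != v %[mod b])%N ->
  2 / beta <= `|sin (pi * (w%:R - v%:R) / beta)|.
Proof.
wlog vw : w v / (v <= w)%N.
  move=> H; have [vw|wv] := leqP v w; first exact: H.
  rewrite eq_sym => /(H _ _ (ltnW wv)).
  by rewrite -opprB mulrN mulNr sinN normrN.
rewrite eqn_mod_dvd// => wv; rewrite -natrB//.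
have B0 : 0 < beta by exact: beta_gt0.
have pi0 := pi_gt0 R.
have cancel (P y : R) : 0 < P -> 2 * (P * y / beta) / P = 2 * y / beta.
  move=> P0; field.
  by rewrite !gt_eqF.
set m := (w - v)%N in wv *.
have -> : pi * m%:R / beta = pi * (m %% b)%:R / beta + pi *+ (m %/ b) :> R.
  rewrite {1}(divn_eq m b) natrD natrM -[pi *+ _]mulr_natr; field.
  by rewrite gt_eqF.
rewrite sin_addnpi.
have r0 : (0 < m %% b)%N by rewrite lt0n.
have rb : (m %% b < b)%N by rewrite ltn_mod; lia.
move: (m %% b)%N r0 rb => r r0 rb {wv m}.
apply: le_trans (ler_norm _).
have r1 : 1 <= r%:R :> R by rewrite ler1n.
have r2 : r%:R <= beta - 1 by rewrite lerBrDr natr1 ler_nat.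
have [h|h] := leP (2 * r%:R) beta.
  apply: le_trans (jordan _).
    by rewrite cancel// ler_pM2r ?invr_gt0// ler_peMr.
  rewrite divr_ge0 ?mulr_ge0 ?(ltW pi0)//= -mulrA ler_pM2l//.
  by rewrite ler_pdivrMr//; move: h; lra.
have -> : sin (pi * r%:R / beta) = sin (pi * (beta - r%:R) / beta) :> R.
  rewrite (_ : pi * (beta - r%:R) / beta = - (pi * r%:R / beta) + pi); last first.
    field.
    by rewrite gt_eqF.
  by rewrite (sinDpi (- _)) sinN opprK.
apply: le_trans (jordan _).
  by rewrite cancel// ler_pM2r ?invr_gt0// ler_peMr//; move: r2; lra.
apply/andP; split.
  by rewrite divr_ge0 ?(ltW B0)// mulr_ge0 ?(ltW pi0)//; move: r2; lra.
by rewrite -mulrA ler_pM2l// ler_pdivrMr//; move: h; lra.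
Qed.

(** A chord of the unit circle: differences of cosines and of sines cannot both be small when the
    angles are far apart. *)
Lemma chord_sqr (x y : R) :
  (cos x - cos y) ^+ 2 + (sin x - sin y) ^+ 2 = 4 * sin ((x - y) / 2) ^+ 2.
Proof.
have e : cos (x - y) = 1 - 2 * sin ((x - y) / 2) ^+ 2.
  rewrite {1}(_ : x - y = ((x - y) / 2) *+ 2); last by rewrite mulr2n; field.
  by rewrite cos_mulr2n cos2sin2 mulr2n; ring.
have -> : 4 * sin ((x - y) / 2) ^+ 2 = 2 - 2 * cos (x - y) by rewrite e; ring.
by rewrite cosB; have := cos2Dsin2 x; have := cos2Dsin2 y; nra.
Qed.

(** Here [g ^+ n] is bounded by 1 and [beta ^- k] serves as the ratio, so the constant does not
    degenerate as [g] tends to 1. *)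
Lemma ser_bound_sharp k N f B z : (0 < k)%N -> 0 <= B -> (forall x, `|f x| <= B) ->
  `|ser b g k N f z| <= B / (beta ^+ k - 1).
Proof.
move=> k0 B0 fB.
have bk0 : 0 < beta ^+ k by rewrite betaX_gt0.
have bk1 : 1 < beta ^+ k by rewrite exprn_egt1 ?ltr1n// -lt0n.
have g0 : 0 < g by apply: lt_trans gb; rewrite invr_gt0 beta_gt0.
have -> : B / (beta ^+ k - 1) = (beta ^- k * B) / (1 - beta ^- k).
  field.
  by rewrite !subr_eq0 !gt_eqF.
apply: (@geometric_sum_le R (beta ^- k) _ _ N (fun n => g ^+ n * beta ^- (k * n.+1) * f (z / beta ^+ n.+1))).
- by rewrite invr_gt0.
- by rewrite invf_lt1.
- by rewrite mulr_ge0// invr_ge0 ltW.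
move=> n; rewrite !normrM -mulrA.
have -> : (beta ^- k) ^+ n * (beta ^- k * B) = 1 * (beta ^- (k * n.+1) * B).
  by rewrite mul1r mulrA -exprSr exprVn -exprM.
rewrite ler_pM//.
  by rewrite ger0_norm ?exprn_ge0 ?(ltW g0)// exprn_ile1 ?ltW.
rewrite ler_pM// ger0_norm// invr_ge0 exprn_ge0//.
Qed.

Lemma ser_diff_split k N f x y :
  ser b g k N.+1 f x - ser b g k N.+1 f y =
  beta ^- k * (f (x / beta) - f (y / beta)) +
  g * beta ^- k * (ser b g k N f (x / beta) - ser b g k N f (y / beta)).
Proof.
rewrite -add1n !ser_split /ser !big_ord1/= !expr1 !muln1 expr0 mul1r; ring.
Qed.

Let beta2 : 2 <= beta. Proof. exact: beta_ge2. Qed.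
Let beta0 : 0 < beta. Proof. exact: beta_gt0. Qed.
Let g0 : 0 < g. Proof. by apply: lt_trans gb; rewrite invr_gt0. Qed.

(** The first term of the second derivative carries the sine; the later terms of the two series add
    at most [2 / (beta ^+ 2 - 1)] in units of [p ^+ 3]. *)
Lemma sin_diff_small N x y (e : R) :
  beta ^+ 2 * `|ser b g 2 N.+1 psi2 x - ser b g 2 N.+1 psi2 y| <= p ^+ 3 * e ->
  `|sin (p * (x / beta)) - sin (p * (y / beta))| <= 2 / (beta ^+ 2 - 1) + e.
Proof.
set X := _ - _ => hX.
have p30 : 0 < p ^+ 3 by rewrite exprn_gt0// (lt_le_trans ltr01).
have sb z : `|ser b g 2 N psi2 z| <= p ^+ 3 / (beta ^+ 2 - 1).
  by apply: ser_bound_sharp => //; exact: psi2_bound.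
have e1 : p ^+ 3 * (sin (p * (x / beta)) - sin (p * (y / beta))) =
  beta ^+ 2 * X - g * (ser b g 2 N psi2 (x / beta) - ser b g 2 N psi2 (y / beta)).
  rewrite /X ser_diff_split /psi2 -/p.
  set Y := _ - ser _ _ _ _ _ _; field.
  by rewrite gt_eqF.
rewrite -(ler_pM2l p30) -[p ^+ 3 in leLHS](ger0_norm (ltW p30)) -normrM e1.
apply: le_trans (ler_normB _ _) _.
rewrite normrM (ger0_norm (exprn_ge0 2 (ltW beta0))) [p ^+ 3 * (_ + e)]mulrDr [X in _ <= X]addrC lerD//.
rewrite normrM (ger0_norm (ltW g0)).
apply: (@le_trans _ _ (1 * (p ^+ 3 / (beta ^+ 2 - 1) + p ^+ 3 / (beta ^+ 2 - 1)))).
  by rewrite ler_pM ?(ltW g0) ?(ltW g1)// (le_trans (ler_normB _ _))// lerD.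
by rewrite le_eqVlt; apply/orP; left; apply/eqP; ring.
Qed.

(** The bound [D] on the later terms stays a parameter, because [b = 2] requires a finer one than
    [ser_bound_sharp]. *)
Lemma cos_diff_small N x y (e D : R) :
  `|ser b g 1 N psi1 (x / beta) - ser b g 1 N psi1 (y / beta)| <= p ^+ 2 * D ->
  beta * `|ser b g 1 N.+1 psi1 x - ser b g 1 N.+1 psi1 y| <= p ^+ 2 * e ->
  `|cos (p * (x / beta)) - cos (p * (y / beta))| <= D + e.
Proof.
set Y := _ - _ => hD; set X := _ - _ => hX.
have p20 : 0 < p ^+ 2 by rewrite exprn_gt0// (lt_le_trans ltr01).
have e1 : p ^+ 2 * (cos (p * (x / beta)) - cos (p * (y / beta))) = - (beta * X) + g * Y.
  rewrite /X ser_diff_split /psi1 -/p -/Y expr1.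
  field.
  by rewrite gt_eqF.
rewrite -(ler_pM2l p20) -[p ^+ 2 in leLHS](ger0_norm (ltW p20)) -normrM e1.
apply: le_trans (ler_normD _ _) _.
rewrite normrN normrM (ger0_norm (ltW beta0)) [p ^+ 2 * (_ + e)]mulrDr [X in _ <= X]addrC lerD//.
by rewrite normrM (ger0_norm (ltW g0)) (le_trans _ hD)// ler_piMl// (ltW g1).
Qed.

(** If both differences were small, the leading cosines and sines at [x1 / b] and [y1 / b] would be
    close, against the chord length, whose square is at least [16 / b ^ 2]. For [b >= 3] geometric
    bounds suffice; for [b = 2] the second term of the first derivative is needed too. *)
Lemma nondegenerate_psi N (w v : nat) x : (0 < N)%N -> (w != v %[mod b])%N ->
  (5 * beta ^+ 3)^-1 <= `|pair_diff b g 1 N psi1 w v x| \/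
  (5 * beta ^+ 3)^-1 <= `|pair_diff b g 2 N psi2 w v x|.
Proof.
case: N => // N _ wv; rewrite /pair_diff.
set x1 := x + w%:R; set y1 := x + v%:R.
apply/orP; rewrite !leNgt -negb_and; apply/negP => /andP[h1 h2].
have b3 : 0 < beta ^+ 3 by rewrite exprn_gt0.
pose e : R := (5 * beta)^-1.
have e0 : 0 < e by rewrite invr_gt0 mulr_gt0.
have be : beta ^+ 2 * (5 * beta ^+ 3)^-1 = e.
  rewrite /e; field.
  by rewrite gt_eqF.
have k2 : beta ^+ 2 * `|ser b g 2 N.+1 psi2 x1 - ser b g 2 N.+1 psi2 y1| <= p ^+ 3 * e.
  apply: (@le_trans _ _ e); last by rewrite ler_peMl ?(ltW e0)// exprn_ege1.
  by rewrite -be ler_wpM2l ?exprn_ge0// ltW.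
have k1 : beta * `|ser b g 1 N.+1 psi1 x1 - ser b g 1 N.+1 psi1 y1| <= p ^+ 2 * e.
  apply: (@le_trans _ _ e); last by rewrite ler_peMl ?(ltW e0)// exprn_ege1.
  rewrite -be expr2 -mulrA ler_wpM2l ?(ltW beta0)//.
  apply: (le_trans (ltW h1)); rewrite ler_peMl ?invr_ge0 ?mulr_ge0 ?(ltW b3)//; move: beta2; lra.
have s1 := sin_diff_small k2.
have cs := chord_sqr (p * (x1 / beta)) (p * (y1 / beta)).
have sg := sin_digits_ge wv.
have ea : (p * (x1 / beta) - p * (y1 / beta)) / 2 = pi * (w%:R - v%:R) / beta.
  by rewrite /p /x1 /y1; field; rewrite gt_eqF.
rewrite ea in cs.
have sg2 : 16 / beta ^+ 2 <= 4 * sin (pi * (w%:R - v%:R) / beta) ^+ 2.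
  have : (2 / beta) ^+ 2 <= sin (pi * (w%:R - v%:R) / beta) ^+ 2.
    by rewrite -[leRHS]real_normK ?num_real// ler_pXn2r ?nnegrE// divr_ge0 ?(ltW beta0).
  by rewrite expr_div_n; lra.
move: s1 cs sg2; set s := sin (p * (x1 / beta)); set s' := sin (p * (y1 / beta)).
set c := cos (p * (x1 / beta)); set c' := cos (p * (y1 / beta)).
move=> s1 cs sg2; rewrite -cs in sg2.
have sq (t u : R) : `|t| <= u -> t ^+ 2 <= u ^+ 2.
  by move=> tu; rewrite -real_normK ?num_real// ler_pXn2r ?nnegrE// (le_trans _ tu).
(* In units of [beta^-1] the two differences are at most 16/5 and 19/20, and the sum of their
   squares is below 16. *)
have [b3'|b3'] := ltnP 2 b.
  have beta3 : 3 <= beta by rewrite ler_nat.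
  have sd z : `|ser b g 1 N psi1 z| <= p ^+ 2 / (beta - 1).
    by rewrite -[X in X - 1]expr1; apply: ser_bound_sharp => //; exact: psi1_bound.
  have c1 : `|c - c'| <= 2 / (beta - 1) + e.
    apply: (@cos_diff_small N x1 y1 e _ _ k1).
    apply: le_trans (ler_normB _ _) _; apply: le_trans (lerD (sd _) (sd _)) _.
    by rewrite le_eqVlt; apply/orP; left; apply/eqP; ring.
  have i0 : 0 < beta^-1 by rewrite invr_gt0.
  have i3 : beta^-1 <= 3^-1 by rewrite lef_pV2 ?posrE.
  have ib : beta^-1 * beta = 1 by rewrite mulVf// gt_eqF.
  have d1 : 2 / (beta - 1) <= 3 * beta^-1.
    by rewrite ler_pdivrMr; [rewrite -mulrA mulrBr ib|]; move: i3 beta3; lra.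
  have d2 : 2 / (beta ^+ 2 - 1) <= 3 / 4 * beta^-1.
    have b9 : 3 * beta <= beta ^+ 2 by rewrite expr2 ler_wpM2r// ltW.
    rewrite ler_pdivrMr; last by move: b9; lra.
    apply: (@le_trans _ _ (3 / 4 * beta^-1 * (3 * beta - 1))).
      by rewrite mulrBr mulr1 mulrACA ib; move: i3; lra.
    by rewrite ler_wpM2l ?mulr_ge0 ?(ltW i0)//; move: b9; lra.
  have ee : e = 5^-1 * beta^-1 by rewrite /e invfM.
  have c2 : (c - c') ^+ 2 <= (16 / 5 * beta^-1) ^+ 2.
    by apply: sq; apply: le_trans c1 _; rewrite ee; move: d1; lra.
  have s2 : (s - s') ^+ 2 <= (19 / 20 * beta^-1) ^+ 2.
    by apply: sq; apply: le_trans s1 _; rewrite ee; move: d2; lra.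
  have i2 : 0 < (beta^-1) ^+ 2 by rewrite exprn_gt0.
  move: sg2 c2 s2 i2; rewrite !exprMn -!exprVn; lra.
(* For [b = 2] the chord is a full diameter, so the two points of the circle are antipodal. *)
have bb : b = 2%N by apply/eqP; rewrite eqn_leq b2 b3'.
have beq : beta = 2 by rewrite bb.
have cs1 : c ^+ 2 + s ^+ 2 = 1 by exact: cos2Dsin2.
have cs1' : c' ^+ 2 + s' ^+ 2 = 1 by exact: cos2Dsin2.
have cc : (c + c') ^+ 2 + (s + s') ^+ 2 <= 0.
  by move: sg2; rewrite beq (_ : 16 / 2 ^+ 2 = 4); [move: cs1 cs1'; nra|rewrite expr2; lra].
have c'E : c' = - c.
  have : (c + c') ^+ 2 = 0.
    by apply/eqP; rewrite eq_le sqr_ge0 andbT; have := sqr_ge0 (s + s'); move: cc; lra.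
  by move/eqP; rewrite sqrf_eq0 => /eqP; lra.
have s'E : s' = - s.
  have : (s + s') ^+ 2 = 0.
    by apply/eqP; rewrite eq_le sqr_ge0 andbT; have := sqr_ge0 (c + c'); move: cc; lra.
  by move/eqP; rewrite sqrf_eq0 => /eqP; lra.
have eE : e = 1 / 10 by rewrite /e beq; field.
(* The cosines of the second terms, tied to those of the first by angle doubling. Antipodality gives
   [a ^+ 2 + a' ^+ 2 = 1] and [|2 * a * a'| = |s|]. *)
pose a := cos (p * (x1 / beta / beta)); pose a' := cos (p * (y1 / beta / beta)).
have double (z : R) : cos (p * z) = 2 * cos (p * (z / beta)) ^+ 2 - 1.
  rewrite {1}(_ : p * z = (p * (z / beta)) *+ 2).
    by rewrite cos_mulr2n [_ *+ 2]mulr2n; ring.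
  by rewrite beq mulr2n; field.
have aE : c = 2 * a ^+ 2 - 1 by exact: double.
have a'E : c' = 2 * a' ^+ 2 - 1 by exact: double.
have c1 : `|c - c'| <= (2^-1 * `|a - a'| + 1) + e.
  apply: (@cos_diff_small N x1 y1 e _ _ k1).
  have p20 : 0 <= p ^+ 2 by rewrite exprn_ge0.
  case: (N) => [|N'].
    by rewrite /ser !big_ord0 subr0 normr0 mulr_ge0// addr_ge0// mulr_ge0.
  have sd z : `|ser b g 1 N' psi1 z| <= p ^+ 2.
    have -> : p ^+ 2 = p ^+ 2 / (beta ^+ 1 - 1) by rewrite expr1 beq; field.
    by apply: ser_bound_sharp => //; exact: psi1_bound.
  rewrite ser_diff_split; apply: le_trans (ler_normD _ _) _; rewrite [p ^+ 2 * (_ + 1)]mulrDr; apply: lerD.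
    rewrite normrM expr1 beq ger0_norm// mulrCA ler_wpM2l//.
    by rewrite /psi1 -/p -mulrBr normrM normrN (ger0_norm p20) -beq.
  rewrite mulr1 !normrM (ger0_norm (ltW g0)) expr1 beq ger0_norm//.
  apply: (@le_trans _ _ (1 * 2^-1 * (p ^+ 2 + p ^+ 2))); last by lra.
  rewrite ler_pM// ?mulr_ge0 ?(ltW g0)//; first by rewrite ler_pM ?(ltW g0) ?(ltW g1).
  by apply: le_trans (ler_normB _ _) _; exact: lerD.
set d := `|a - a'| in c1.
have d0 : 0 <= d by exact: normr_ge0.
have dd : d ^+ 2 <= 1 + `|s|.
  have aa : (2 * a * a') ^+ 2 = s ^+ 2 by move: aE a'E cs1; rewrite c'E; nra.
  have aa' : `|2 * a * a'| = `|s|.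
    by apply/eqP; rewrite -(@eqrXn2 _ 2)// !real_normK ?num_real// aa.
  have := ler_norm (- (2 * a * a')); rewrite normrN aa' /d real_normK ?num_real//.
  by move: aE a'E; rewrite c'E; nra.
have dbl (t : R) : `|t - - t| = 2 * `|t| by rewrite opprK -mulr2n normrMn mulr_natl.
have sl : `|s| <= 23 / 60.
  by move: s1; rewrite s'E dbl eE beq (_ : 2 ^+ 2 - 1 = 3); [lra|rewrite expr2; lra].
have cl : 2 * `|c| <= 11 / 10 + 2^-1 * d.
  by move: c1; rewrite c'E dbl eE; lra.
have c2 : `|c| ^+ 2 + `|s| ^+ 2 = 1 by rewrite !real_normK ?num_real.
(* Numerical contradiction: [S <= 23 / 60] forces [C >= 23 / 25], hence [D >= 37 / 25], so that
   [D ^+ 2] exceeds 2 while it should be at most [1 + S]. *)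
move: (normr_ge0 c) (normr_ge0 s) sl cl c2 dd d0 => {c1}.
move: `|c| `|s| d => C S D hC hS hS2 hCD hCS hD hD0.
have C9 : 23 / 25 <= C by rewrite leNgt; apply/negP => hC9; nra.
have D1 : 37 / 25 <= D by lra.
nra.
Qed.

Theorem psi_correlation_bound : exists2 C, 0 < C & forall N L r,
  g ^+ N <= r -> beta ^- L <= r -> correlation b g psi N L r <= C * r * beta ^+ (L + 2 * N).
Proof.
apply: (@correlation_bound R b g b2 gb g1 psi psi1 psi2 (p ^+ 4) (5 * beta ^+ 3)^-1).
- by rewrite exprn_ege1.
- exact: psi_periodic.
- exact: psi1_periodic.
- by move=> x; apply: le_trans (psi1_bound x) _; exact: p_le4.
- exact: psi_lip.
- exact: psi1_lip.
- exact: psi_taylor.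
- exact: psi1_taylor.
- by rewrite invr_gt0 mulr_gt0// exprn_gt0.
- by move=> N w v x; exact: nondegenerate_psi.
Qed.

End sine.

(** * Densities from averages over balls *)

Section limn_einf.
Context {R : realType}.
Local Open Scope ereal_scope.

Lemma limn_einf_le (u : (\bar R)^nat) (M : \bar R) : (forall n, u n <= M) -> limn_einf u <= M.
Proof.
move=> uM; rewrite limn_einf_lim; apply: lime_le; first exact: is_cvg_einfs.
apply: nearW => n; apply: le_trans (uM n); apply: ereal_inf_lbound.
by exists n => /=.
Qed.

Lemma limn_einf_ge0 (u : (\bar R)^nat) : (forall n, 0 <= u n) -> 0 <= limn_einf u.
Proof.
move=> u0; rewrite limn_einf_lim; apply: lime_ge; first exact: is_cvg_einfs.
by apply: nearW => n; apply: le_ereal_inf_tmp => _ [m _ <-].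
Qed.

Lemma limn_einf_frequently (u : (\bar R)^nat) (M : \bar R) : limn_einf u < M ->
  forall N, exists2 n, (N <= n)%N & u n < M.
Proof.
move=> uM N; have : einfs u N < M.
  apply: le_lt_trans uM; rewrite limn_einf_lim.
  apply: lime_ge; first exact: is_cvg_einfs.
  by exists N => // n /= Nn; exact: nondecreasing_einfs.
by move=> /ereal_inf_lt[_ [n /= Nn <-] h]; exists n.
Qed.

End limn_einf.

Section density.
Context {R : realType}.
Variable mu : {finite_measure set (measurableTypeR R) -> \bar R}.
Local Notation leb := (@lebesgue_measure R).
Local Open Scope ereal_scope.

Definition ball_mean (e y : R) : R := (fine (mu (ball y e)) / (2 * e))%R.

Lemma measurable_near_diag (e : R) :
  measurable [set z : measurableTypeR R * measurableTypeR R | ball z.1 e z.2].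
Proof.
rewrite [X in measurable X](_ : _ = (fun z : measurableTypeR R * measurableTypeR R =>
    `|(z.1 : R) - (z.2 : R)|%R) @^-1` `]-oo, e[); last first.
  by apply/seteqP; split => z /=; rewrite in_itv.
rewrite -[X in measurable X]setTI.
apply: measurableT_comp => //.
by apply: measurable_funB.
Qed.

Lemma measurable_ball_measure (m : {sigma_finite_measure set (measurableTypeR R) -> \bar R}) e :
  measurable_fun setT (fun y : measurableTypeR R => m (ball y e)).
Proof.
rewrite (_ : (fun y => _) = m \o xsection [set z : measurableTypeR R * measurableTypeR R | ball z.1 e z.2]).
  by apply: measurable_fun_xsection; exact: measurable_near_diag.
by apply/funext => y /=; congr (m _); apply/seteqP; split => s; rewrite /xsection/= inE.
Qed.

Lemma measurable_ball_mean e : measurable_fun setT (ball_mean e).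
Proof.
apply: measurable_funM; last exact: measurable_cst.
apply: measurableT_comp => //; exact: measurable_ball_measure.
Qed.

Lemma ball_mean_ge0 e y : (0 < e -> 0 <= ball_mean e y)%R.
Proof. by move=> e0; rewrite divr_ge0 ?fine_ge0// mulr_ge0// ltW. Qed.

Lemma ball_meanE e y : (0 < e)%R -> (ball_mean e y)%:E = mu (ball y e) * ((2 * e)^-1)%:E.
Proof. by move=> e0; rewrite EFinM fineK// fin_num_measure//; exact: measurable_ball. Qed.

Variables (e : R^nat) (H : R).
Hypothesis e_gt0 : forall n, (0 < e n)%R.
Hypothesis e_cvg0 : e n @[n --> \oo] --> (0 : R)%R.
Hypothesis H0 : (0 <= H)%R.
Hypothesis means_L2 : forall n, \int[leb]_y ((ball_mean (e n) y ^+ 2)%R)%:E <= H%:E.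

(** By Fubini the [mu]-integral over [U] of the normalised Lebesgue measure of [ball s (e n) & U] is
    the Lebesgue integral over [U] of the ball means, to which [2 * t <= c * t ^+ 2 + c^-1] applies.
    As [U] is open, the first integrand tends to 1 on [U], and Fatou's lemma concludes. *)
Lemma measure_open_le (U : set R) (c : R) : open U -> (0 < c)%R ->
  mu U <= 2^-1%:E * (c%:E * H%:E + c^-1%:E * leb U).
Proof.
move=> oU c0.
have mU : measurable U by exact: open_measurable.
pose phi n (s : measurableTypeR R) := leb (ball s (e n) `&` U) * ((2 * e n)^-1)%:E.
have e2 n : (0 < 2 * e n)%R by rewrite mulr_gt0.
pose A n := [set z : measurableTypeR R * measurableTypeR R | ball z.1 (e n) z.2] `&` (setT `*` U).
have mA n : measurable (A n).
  by apply: measurableI; [exact: measurable_near_diag|exact: measurableX].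
have phiE n (s : measurableTypeR R) : leb (ball s (e n) `&` U) = (leb \o xsection (A n)) s.
  rewrite /=; congr (leb _); apply/seteqP; split => y; rewrite /xsection/= inE /A/=.
    by case.
  by case=> ? [_ ?].
have mphi n : measurable_fun [set: measurableTypeR R] (phi n).
  apply: emeasurable_funM => //.
  rewrite (_ : (fun s => _) = leb \o xsection (A n)); last by apply/funext => s; exact: phiE.
  exact: (@measurable_fun_xsection _ _ (measurableTypeR R) (measurableTypeR R) R leb (A n) (mA n)).
have phi0 n (s : measurableTypeR R) : 0 <= phi n s.
  by rewrite mule_ge0// lee_fin invr_ge0 ltW.
have phi_le n : \int[mu]_(s in U) phi n s <= 2^-1%:E * (c%:E * H%:E + c^-1%:E * leb U).
  apply: (@le_trans _ _ (\int[mu]_s phi n s)).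
    by apply: ge0_subset_integral => //.
  rewrite ge0_integralZr//; last 2 first.
    by rewrite (_ : (fun s => _) = leb \o xsection (A n)); [exact: measurable_fun_xsection|apply/funext => s; exact: phiE].
    by rewrite lee_fin invr_ge0 ltW.
  have -> : \int[mu]_s leb (ball s (e n) `&` U) = \int[leb]_(y in U) mu (ball y (e n)).
    have := indic_fubini_tonelli mu leb (mA n).
    rewrite indic_fubini_tonelli_FE// indic_fubini_tonelli_GE// => h.
    under eq_integral do rewrite phiE.
    rewrite h [RHS]integral_mkcond; apply: eq_integral => y _ /=.
    rewrite patchE; case: ifPn => yU.
      congr (mu _); apply/seteqP; split => s; rewrite /ysection/= inE /A/=.
        by case=> + _; exact: ball_sym.
      by move=> sy; split; [exact: ball_sym|split => //; rewrite inE in yU].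
    rewrite (_ : ysection _ _ = set0) ?measure0//; apply/seteqP; split => s //.
    rewrite /ysection/= inE /A/= => -[_ [_ Uy]]; by move: yU; rewrite notin_setE.
  rewrite -ge0_integralZr//; last 2 first.
    by apply: measurable_funTS; exact: measurable_ball_measure.
    by rewrite lee_fin invr_ge0 ltW.
  under eq_integral do rewrite -ball_meanE//.
  apply: (@le_trans _ _ (\int[leb]_(y in U) (2^-1%:E * (c%:E * (ball_mean (e n) y ^+ 2)%R%:E + c^-1%:E)))).
    apply: ge0_le_integral => //.
    - by move=> y _; rewrite lee_fin ball_mean_ge0.
    - by apply: measurable_funTS; apply/measurable_EFinP; exact: measurable_ball_mean.
    - apply/measurable_funTS; apply: emeasurable_funM => //; apply: emeasurable_funD => //.
      apply: emeasurable_funM => //; apply/measurable_EFinP.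
      by apply: measurable_funX; exact: measurable_ball_mean.
    - move=> y _; rewrite [leRHS](_ : _ = (2^-1 * (c * ball_mean (e n) y ^+ 2 + c^-1))%:E)// lee_fin.
      have i0 : (0 < c^-1)%R by rewrite invr_gt0.
      set t := ball_mean _ _; have ht := sqr_ge0 (c * t - 1)%R.
      have := mulr_ge0 (ltW i0) ht.
      have -> : (c^-1 * (c * t - 1) ^+ 2 = c * t ^+ 2 - 2 * t + c^-1)%R.
        field.
        by rewrite gt_eqF.
      lra.
  have mb2 : measurable_fun U (fun y : measurableTypeR R => ((ball_mean (e n) y ^+ 2)%R)%:E).
    apply: measurable_funTS; apply/measurable_EFinP.
    by apply: measurable_funX; exact: measurable_ball_mean.
  have b20 (y : measurableTypeR R) : 0 <= ((ball_mean (e n) y ^+ 2)%R)%:E.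
    by rewrite lee_fin sqr_ge0.
  have ic0 : 0 <= (c^-1)%:E by rewrite lee_fin invr_ge0 ltW.
  have c0' : 0 <= c%:E by rewrite lee_fin ltW.
  rewrite ge0_integralZl//; last 2 first.
  - by apply: emeasurable_funD => //; apply: emeasurable_funM.
  - by move=> y _; rewrite adde_ge0// mule_ge0.
  rewrite ge0_integralD//; last 2 first.
  - by move=> y _; rewrite mule_ge0.
  - by apply: emeasurable_funM.
  rewrite ge0_integralZl// integral_cst// lee_pmul2l// ?lte_fin//.
  rewrite leeD2r// lee_pmul2l ?lte_fin//.
  apply: le_trans (means_L2 n); apply: ge0_subset_integral => //.
  apply/measurable_EFinP; apply: measurable_funX; exact: measurable_ball_mean.
have -> : mu U = \int[mu]_(s in U) limn_einf (phi^~ s).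
  rewrite -[LHS]mul1e -integral_cst//; apply: eq_integral => s; rewrite inE => Us.
  have phi1 : phi n s @[n --> \oo] --> 1.
    apply: cvg_near_cst.
    have /nbhs_ballP[r /= r0 rU] : nbhs (s : R) U by apply: open_nbhs_nbhs; split.
    have : \forall n \near \oo, (e n < r)%R.
      move/cvgrPdist_lt : e_cvg0 => /(_ _ r0); apply: filterS => n /=.
      by rewrite sub0r normrN gtr0_norm.
    apply: filterS => n enr; rewrite /phi.
    rewrite (_ : ball s (e n) `&` U = ball s (e n)); last first.
      by apply/setIidPl => y /(le_ball (ltW enr)); exact: rU.
    rewrite lebesgue_measure_ball; last exact: ltW.
    by rewrite -(mulr_natl (e n) 2) -EFinM mulfV// gt_eqF.
  by have [->] := cvg_limn_einf_sup phi1.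
apply: le_trans (fatou _ _ _ _) _ => //.
  by move=> n; exact: measurable_funTS.
exact: limn_einf_le.
Qed.

Lemma ball_means_dominated : mu `<< leb.
Proof.
apply/null_content_dominatesP => A mA A0.
apply/eqP; rewrite eq_le measure_ge0 andbT; apply/lee_addgt0Pr => d d0; rewrite add0e.
(* With [leb U <= c ^+ 2] the bound for open sets becomes [c * (H + 1) / 2 = d / 2]. *)
pose c := (d / (H + 1))%R.
have c0 : (0 < c)%R by rewrite divr_gt0// ltr_wpDl.
have lA : leb A < +oo by rewrite (_ : leb A = 0)//.
have [U [oU AU UA]] := lebesgue_regularity_outer mA lA (exprn_gt0 2 c0).
have mU : measurable U by exact: open_measurable.
have lU : leb U <= (c ^+ 2)%:E.
  apply: (@le_trans _ _ (leb A + leb (U `\` A))).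
    apply: le_trans (measureU2 _ _ _) => //; last exact: measurableD.
    apply: le_measure; rewrite ?inE//; first by apply: measurableU => //; exact: measurableD.
    by move=> y Uy; have [Ay|Ay] := pselect (A y); [left|right].
  by rewrite (_ : leb A = 0)// add0e ltW.
apply: (@le_trans _ _ (mu U)); first by apply: le_measure; rewrite ?inE.
apply: le_trans (measure_open_le oU c0) _.
apply: (@le_trans _ _ (2^-1 * (c * H + c^-1 * c ^+ 2))%:E).
  rewrite [leRHS](_ : _ = 2^-1%:E * (c%:E * H%:E + c^-1%:E * (c ^+ 2)%:E))//.
  apply: lee_wpmul2l; first by rewrite lee_fin.
  by rewrite leeD2l// lee_wpmul2l// lee_fin invr_ge0 ltW.
rewrite lee_fin expr2 mulKf ?gt_eqF// -[X in (_ + X)%R]mulr1 -mulrDr /c divfK ?gt_eqF ?ltr_wpDl//.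
by move: d0; lra.
Qed.

Lemma measurable_fun_limn_einf d (T : measurableType d) (D : set T) (f : (T -> \bar R)^nat) :
  (forall n, measurable_fun D (f n)) -> measurable_fun D (fun x => limn_einf (f^~ x)).
Proof.
move=> mf; have -> : (fun x => limn_einf (f^~ x)) = (fun x => - limn_esup (fun n => - f n x)).
  by apply/funext => x; rewrite -[LHS]oppeK -limn_esupN.
apply: measurableT_comp => //; apply: measurable_fun_limn_esup => n.
exact: measurableT_comp.
Qed.

(** The last clause allows any radii [r], not only [e]: below, [e] is a subsequence depending on
    [x], whereas the density must be read off one common sequence to be measurable in both
    variables. *)
Theorem ball_means_density : exists g : R -> R,
  [/\ measurable_fun setT g, (forall y, 0 <= g y)%R,
      \int[leb]_y ((g y ^+ 2)%R)%:E <= H%:E,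
      (forall A, measurable A -> mu A = \int[leb]_(y in A) (g y)%:E) &
      forall r : R^nat, (forall n, 0 < r n)%R -> r n @[n --> \oo] --> (0 : R)%R ->
        {ae leb, forall y, (ball_mean (r n) y)%:E @[n --> \oo] --> (g y)%:E}].
Proof.
have [f [f0 ffin fint fE]] := radon_nikodym_sigma_finite ball_means_dominated.
pose g (y : R) := fine (f y).
have gE y : (g y)%:E = f y by rewrite fineK.
have g0 y : (0 <= g y)%R by exact: fine_ge0.
have mf : measurable_fun setT f by exact: measurable_int fint.
have mg : measurable_fun setT g by apply: measurableT_comp.
have muE A : measurable A -> mu A = \int[leb]_(y in A) (g y)%:E.
  by move=> mA; rewrite fE//; apply: eq_integral => y _; rewrite gE.
have ig : leb.-integrable setT (EFin \o g).
  by apply: eq_integrable fint => // y _ /=; rewrite gE.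
have lg : locally_integrable setT g.
  by apply: open_integrable_locally => //; exact: openT.
have lim r : (forall n, 0 < r n)%R -> r n @[n --> \oo] --> (0 : R)%R ->
    {ae leb, forall y, (ball_mean (r n) y)%:E @[n --> \oo] --> (g y)%:E}.
  move=> r0 rcvg.
  pose E (y : R) n := ball y (r n).
  have hE y : nicely_shrinking y (E y).
    split; first by move=> n; exact: measurable_ball.
    exists (1%R, fun n => PosNum (r0 n)); split => //= n; first by [].
    by rewrite mul1e.
  have := lebesgue_differentiation lg.
  apply: filterS; first exact: (ae_filter_ringOfSetsType leb).
  move=> y /(nice_lebesgue_differentiation hE lg).
  suff -> : (fun n => (ball_mean (r n) y)%:E) =
    (fun n => (leb (E y n))^-1 * \int[leb]_(z in E y n) (g z)%:E) by [].
  apply/funext => n.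
  rewrite -muE; last exact: measurable_ball.
  rewrite ball_meanE// lebesgue_measure_ball; last exact: ltW.
  rewrite -(mulr_natl (r n) 2) inver gt_eqF ?mulr_gt0//; exact: muleC.
exists g; split => //.
apply: (@le_trans _ _ (\int[leb]_y limn_einf (fun n => ((ball_mean (e n) y ^+ 2)%R)%:E))).
  have mb n : measurable_fun setT (fun y : measurableTypeR R => ((ball_mean (e n) y ^+ 2)%R)%:E).
    by apply/measurable_EFinP; apply: measurable_funX; exact: measurable_ball_mean.
  apply: ae_ge0_le_integral => //.
  - by move=> y _; rewrite lee_fin sqr_ge0.
  - by apply/measurable_EFinP; apply: measurable_funX.
  - by move=> y _; apply: limn_einf_ge0 => n; rewrite lee_fin sqr_ge0.
  - exact: measurable_fun_limn_einf.
  have := lim e e_gt0 e_cvg0; apply: filterS; first exact: (ae_filter_ringOfSetsType leb).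
  move=> y h _.
  have h2 : ((ball_mean (e n) y ^+ 2)%R)%:E @[n --> \oo] --> ((g y ^+ 2)%R)%:E.
    have hr : ball_mean (e n) y @[n --> \oo] --> g y by exact: fine_cvg h.
    apply/fine_cvgP; split; first exact: nearW.
    exact: (cvgM hr hr).
  by have [->] := cvg_limn_einf_sup h2.
apply: le_trans (fatou _ _ _ _) _ => //.
- by move=> n; apply/measurable_EFinP; apply: measurable_funX; exact: measurable_ball_mean.
- by move=> n y _; rewrite lee_fin sqr_ge0.
exact: limn_einf_le.
Qed.

End density.

(** * Coding by digits *)

Section coding.
Variables (b : nat) (T : Type) (iota : nat -> T -> nat).
Hypothesis b2 : (2 <= b)%N.
Hypothesis iota_lt : forall n w, (iota n w < b)%N.

Definition word N (w : T) : nat := (\sum_(k < N) iota k w * b ^ k)%N.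

Lemma word_add n m w : exists k, word (n + m) w = (word n w + b ^ n * k)%N.
Proof.
exists (\sum_(k < m) iota (n + k) w * b ^ k)%N.
rewrite /word big_split_ord/=; congr addn; rewrite big_distrr/=; apply: eq_bigr => i _.
by rewrite expnD mulnCA.
Qed.

Lemma word_lt N w : (word N w < b ^ N)%N.
Proof.
elim: N => [|N IH]; first by rewrite /word big_ord0 expn0.
rewrite /word big_ord_recr/= -/(word N w) expnS.
have h := iota_lt N w.
apply: (@leq_trans (b ^ N + iota N w * b ^ N)); first by rewrite ltn_add2r.
by rewrite -mulSn leq_mul2r h orbT.
Qed.

Lemma word_digit N j w : (j < N)%N -> iota j w = (word N w %/ b ^ j %% b)%N.
Proof.
move=> jN; have [k] := word_add j.+1 (N - j.+1) w; rewrite subnKC// => ->.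
have -> : (word j.+1 w + b ^ j.+1 * k = word j w + (iota j w + b * k) * b ^ j)%N.
  by rewrite /word big_ord_recr/= mulnDl -addnA expnSr; congr (_ + (_ + _))%N; lia.
rewrite addnC divnMDl ?expn_gt0 ?(ltnW b2)// divn_small ?word_lt// addn0.
by rewrite addnC mulnC modnMDl modn_small.
Qed.

End coding.

(** * Convergence of S and truncation error *)

Section partial_sums.
Context {R : realType} (b : nat) (g : R).
Hypothesis b2 : (2 <= b)%N.
Hypotheses (g0 : 0 < g) (g1 : g < 1).
Variables (T : Type) (iota : nat -> T -> nat).
Local Notation beta := (b%:R : R).

Lemma partial_sum_ser N (x : R) w :
  \sum_(0 <= n < N) (g ^+ n * psi ((x + \sum_(k < n.+1) (iota k w)%:R * beta ^+ k) / beta ^+ n.+1)) =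
  ser b g 0 N psi (x + (word b iota N w)%:R).
Proof.
rewrite big_mkord; apply: eq_bigr => -[n nN] _ /=.
rewrite mul0n expr0 invr1 mulr1; congr (_ * _).
have -> : \sum_(k < n.+1) (iota k w)%:R * beta ^+ k = (word b iota n.+1 w)%:R.
  by rewrite /word natr_sum; apply: eq_bigr => k _; rewrite natrM natrX.
have [k e] := word_add b iota n.+1 (N - n.+1) w; rewrite subnKC// in e.
rewrite e natrD natrM natrX addrA [in RHS]mulrDl mulrAC divff; last first.
  by rewrite expf_neq0// pnatr_eq0; lia.
by rewrite mul1r psi_periodic.
Qed.

(** As [(2 * pi) ^+ 4] bounds both [psi] and its Lipschitz constant, this number controls the
    truncation error and is also a Lipschitz constant of the partial sums. *)
Definition tail_const : R := (2 * pi) ^+ 4 / (1 - g).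

Lemma tail_const_ge0 : 0 <= tail_const.
Proof. by rewrite divr_ge0 ?exprn_ge0 ?mulr_ge0 ?pi_ge0// subr_ge0 ltW. Qed.

Lemma partial_sum_dist n m (x : R) w :
  `|ser b g 0 (n + m) psi (x + (word b iota (n + m) w)%:R) -
    ser b g 0 n psi (x + (word b iota n w)%:R)| <= tail_const * g ^+ n.
Proof.
have [k ->] := word_add b iota n m w.
rewrite ser_digits//; last exact: psi_periodic.
rewrite addrAC subrr add0r mul0n expr0 invr1 mulr1 normrM ger0_norm ?exprn_ge0 ?(ltW g0)//.
rewrite mulrC ler_wpM2r ?exprn_ge0 ?(ltW g0)//.
apply: ser_bound => //; first by rewrite exprn_ge0// mulr_ge0// pi_ge0.
exact: psi_bound.
Qed.

Lemma Sfun_cvg (x : R) w :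
  ser b g 0 N psi (x + (word b iota N w)%:R) @[N --> \oo] --> Sfun b g iota x w.
Proof.
pose a n := g ^+ n * psi ((x + \sum_(k < n.+1) (iota k w)%:R * beta ^+ k) / beta ^+ n.+1).
have -> : (fun N => ser b g 0 N psi (x + (word b iota N w)%:R)) = series a.
  by apply/funext => N; rewrite -partial_sum_ser.
have p4 : 0 <= (2 * pi : R) ^+ 4 by rewrite exprn_ge0// mulr_ge0// pi_ge0.
suff : cvgn (series a) by [].
apply: normed_cvg; apply: (@series_le_cvg _ _ (geometric ((2 * pi) ^+ 4) g)).
- by move=> n; exact: normr_ge0.
- by move=> n; rewrite /geometric/= mulr_ge0// exprn_ge0// ltW.
- move=> n; rewrite /geometric/= /a normrM (ger0_norm (exprn_ge0 n (ltW g0))) mulrC.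
  by rewrite ler_wpM2r ?exprn_ge0 ?(ltW g0)//; exact: psi_bound.
- by apply: is_cvg_geometric_series; rewrite gtr0_norm.
Qed.

Lemma Sfun_dist N (x : R) w :
  `|Sfun b g iota x w - ser b g 0 N psi (x + (word b iota N w)%:R)| <= tail_const * g ^+ N.
Proof.
apply/ler_addgt0Pr => e e0.
have /cvgrPdist_le/(_ _ e0)[M _ hM] := @Sfun_cvg x w.
have h1 := hM (N + M)%N (leq_addl _ _); have h2 := partial_sum_dist N M x w.
set s := Sfun _ _ _ _ _ in h1 *; set u := ser _ _ _ (N + M) _ _ in h1 h2.
set v := ser _ _ _ N _ _ in h2 *.
have -> : s - v = (u - v) + (s - u) by ring.
by apply: le_trans (ler_normD _ _) _; exact: lerD.
Qed.

End partial_sums.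

(** * Distribution of words and measurability of S *)

Section law.
Context {R : realType} (b : nat) (g : R) (d : measure_display) (Omega : measurableType d)
  (P : probability Omega R) (iota : nat -> Omega -> nat).
Hypothesis b2 : (2 <= b)%N.
Hypotheses (g0 : 0 < g) (g1 : g < 1).
Hypothesis model : bernoulli_model b P iota.
Local Notation beta := (b%:R : R).

Lemma measurable_iota n : measurable_fun setT (iota n).
Proof.
have [_ mi _] := model.
move=> _ A _; rewrite setTI.
rewrite (_ : _ @^-1` A = \bigcup_(k in A) [set w | iota n w = k]).
  by apply: bigcup_measurable => k _; exact: mi.
by apply/seteqP; split => w /=; [move=> Aw; exists (iota n w)|case=> k Ak /= ->].
Qed.

Lemma measurable_word N : measurable_fun setT (fun w => word b iota N w).
Proof.
elim: N => [|N IH].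
  rewrite (_ : (fun w => _) = cst 0%N); first exact: measurable_cst.
  by apply/funext => w; rewrite /word big_ord0.
rewrite (_ : (fun w => _) = (fun w => word b iota N w + iota N w * b ^ N)%N).
  apply: measurable_fun_addn => //.
  by apply: (measurableT_comp (f := fun k : nat => (k * b ^ N)%N)) => //; exact: measurable_iota.
by apply/funext => w; rewrite /word big_ord_recr.
Qed.

(** The event is covered by the cylinders of the words [m] with [Q m], each of mass [beta ^- N];
    subadditivity spares their disjointness. *)
Lemma word_law_le N (Q : nat -> bool) :
  (P [set w | Q (word b iota N w)] <= (beta ^- N * \sum_(m < b ^ N) (Q m)%:R)%:E)%E.
Proof.
have [il mi cyl] := model.
pose dig (m j : nat) := (m %/ b ^ j %% b)%N.
pose C m := [set w | forall j, (j < N)%N -> iota j w = dig m j].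
have mC m : measurable (C m).
  rewrite (_ : C m = \bigcap_j [set w | (j < N)%N -> iota j w = dig m j]).
    apply: bigcapT_measurable => j; case: (ltnP j N) => jN.
      by rewrite (_ : [set w | _] = [set w | iota j w = dig m j])//;
        apply/seteqP; split => w /=; [exact|].
    by rewrite (_ : [set w | _] = setT)//; apply/seteqP; split.
  by apply/seteqP; split => w /= h => [j _|j]; exact: h.
pose A m := if Q m then C m else set0.
have mA m : measurable (A m) by rewrite /A; case: ifP.
apply: (@le_trans _ _ (P (\big[setU/set0]_(m < b ^ N) A m))).
  apply: le_measure; rewrite ?inE.
  - by have := @measurable_word N measurableT [set m | Q m] I; rewrite setTI.
  - exact: bigsetU_measurable.
  - move=> w /= Qw; rewrite -bigcup_mkord; exists (word b iota N w) => /=.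
      exact: word_lt.
    by rewrite /A Qw => j jN; exact: word_digit.
apply: le_trans (Boole_inequality _ _) _ => //.
rewrite mulr_sumr -sumEFin; apply: lee_sum => m _; rewrite /A; case: (Q m).
  rewrite mulr1 le_eqVlt; apply/orP; left; apply/eqP.
  by apply: (cyl N (dig m)) => j _; rewrite ltn_mod; exact: ltnW.
by rewrite measure0 mulr0.
Qed.

Lemma measurable_psi : measurable_fun setT (psi : measurableTypeR R -> R).
Proof.
apply: measurable_funM => //.
apply: (measurableT_comp (f := sin)); last exact: measurable_funM.
by apply: continuous_measurable_fun; exact: continuous_sin.
Qed.

Lemma measurable_ser k N : measurable_fun setT (ser b g k N psi : measurableTypeR R -> R).
Proof.
apply: measurable_sum => n; apply: measurable_funM => //.
by apply: measurableT_comp; [exact: measurable_psi|exact: measurable_funM].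
Qed.

Lemma measurable_Sfun :
  measurable_fun setT (fun z : measurableTypeR R * Omega => Sfun b g iota z.1 z.2).
Proof.
apply: (@measurable_fun_cvg _ _ _ _
  (fun N (z : measurableTypeR R * Omega) => ser b g 0 N psi (z.1 + (word b iota N z.2)%:R))).
  move=> N; apply: measurableT_comp; first exact: measurable_ser.
  apply: measurable_funD => //.
  apply: (measurableT_comp (f := fun k : nat => k%:R : R)) => //.
  by apply: measurableT_comp => //; exact: measurable_word.
by move=> z _; exact: Sfun_cvg.
Qed.

End law.

(** * Absolute continuity *)

Section step_functions.
Context {R : realType}.
Local Notation leb := (@lebesgue_measure R).

Lemma integral_step (D : set (measurableTypeR R)) (M : nat) (c l : nat -> R) (A : nat -> set (measurableTypeR R)) :
  measurable D -> (forall m, 0 <= c m) -> (forall m, measurable (A m)) ->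
  (forall m, leb (A m) <= (l m)%:E)%E ->
  (\int[leb]_(y in D) (\sum_(m < M) c m * \1_(A m) y)%:E <= (\sum_(m < M) c m * l m)%:E)%E.
Proof.
move=> mD c0 mA lA; under eq_integral do rewrite -sumEFin.
rewrite ge0_integral_sum//; last 2 first.
- by move=> m; apply/measurable_EFinP; apply: measurable_funM => //; exact: measurable_indic.
- by move=> m y _; rewrite lee_fin mulr_ge0.
rewrite -sumEFin; apply: lee_sum => m _.
under eq_integral do rewrite EFinM.
rewrite ge0_integralZl//; last 2 first.
- by apply/measurable_EFinP; exact: measurable_indic.
- by rewrite lee_fin.
rewrite EFinM lee_wpmul2l ?lee_fin// integral_indic//.
apply: le_trans (lA m); apply: le_measure; rewrite ?inE//; first exact: measurableI.
Qed.

End step_functions.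

(** * Comparison of grid sums with integrals *)

Section grid_integral.
Context {R : realType} (b : nat) (g : R).
Hypothesis b2 : (2 <= b)%N.
Hypotheses (g0 : 0 < g) (g1 : g < 1).
Local Notation beta := (b%:R : R).
Local Notation leb := (@lebesgue_measure R).
Local Notation K := (tail_const g).
Local Notation G N := (ser b g 0 N psi).
Local Notation pairs := (close_pairs b g psi).

Lemma sum_shift (M : nat) (F : nat -> R) : F M = F 0%N ->
  \sum_(w < M) F w.+1 = \sum_(w < M) F w.
Proof.
move=> FM; case: M FM => [|M FM]; first by rewrite !big_ord0.
by rewrite big_ord_recr big_ord_recl/= FM addrC.
Qed.

(** Translation by 1 shifts the words cyclically, since [b ^ N] is a period of the partial sum. *)
Lemma close_pairs_periodic1 N (x r : R) : pairs N (x + 1) r = pairs N x r.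
Proof.
have per : G N (x + (b ^ N)%:R) = G N (x + 0%:R).
  rewrite addr0 -[(b ^ N)%N]muln1 ser_periodic//; exact: psi_periodic.
have S (w : nat) : x + 1 + w%:R = x + w.+1%:R by rewrite -natr1; ring.
rewrite /close_pairs /pair_diff.
under eq_bigr do under eq_bigr do rewrite !S.
rewrite (@sum_shift (b ^ N)
  (fun w => \sum_(v < b ^ N) (`|G N (x + w%:R) - G N (x + v.+1%:R)| < r)%R%:R)); last by rewrite per.
apply: eq_bigr => w _.
by rewrite (@sum_shift (b ^ N) (fun v => (`|G N (x + w%:R) - G N (x + v%:R)| < r)%R%:R))// per.
Qed.

Lemma close_pairs_periodic N (x r : R) (a : int) : pairs N (x - a%:~R) r = pairs N x r.
Proof.
have pn (n : nat) y : pairs N (y + n%:R) r = pairs N y r.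
  elim: n => [|n IH]; first by rewrite addr0.
  by rewrite -natr1 addrA close_pairs_periodic1.
case: a => n; last by rewrite NegzE rmorphN opprK pn.
by rewrite -(pn n) -pmulrn subrK.
Qed.

Lemma G_lip N (x y : R) : `|G N x - G N y| <= K * `|x - y|.
Proof.
apply: ser_lip => //; first by rewrite exprn_ge0// mulr_ge0// pi_ge0.
exact: psi_lip.
Qed.

Lemma close_pairs_near N (x y r e : R) : 2 * K * `|x - y| <= e ->
  pairs N x r <= pairs N y (r + e).
Proof.
move=> xy; apply: ler_sum => w _; apply: ler_sum => v _; rewrite ler_nat.
case: (ltP `|pair_diff _ _ _ _ _ _ _ x| r) => //= h; rewrite lt0b.
have dw : `|G N (y + w%:R) - G N (x + w%:R)| <= K * `|x - y|.
  by apply: le_trans (G_lip _ _ _) _; rewrite opprD addrACA subrr addr0 distrC.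
have dv : `|G N (y + v%:R) - G N (x + v%:R)| <= K * `|x - y|.
  by apply: le_trans (G_lip _ _ _) _; rewrite opprD addrACA subrr addr0 distrC.
move: h; rewrite /pair_diff => h.
have -> : G N (y + w%:R) - G N (y + v%:R) = (G N (x + w%:R) - G N (x + v%:R)) +
   ((G N (y + w%:R) - G N (x + w%:R)) - (G N (y + v%:R) - G N (x + v%:R))) by ring.
apply: le_lt_trans (ler_normD _ _) _; apply: ltr_leD h _.
by apply: le_trans (ler_normB _ _) _; move: dw dv xy; lra.
Qed.

Lemma measurable_close_pairs N r :
  measurable_fun setT (pairs N ^~ r : measurableTypeR R -> R).
Proof.
apply: measurable_sum => w; apply: measurable_sum => v.
pose h (x : measurableTypeR R) := `|pair_diff b g 0 N psi w v x|.
have mh : measurable_fun setT h.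
  apply: measurableT_comp => //; apply: measurable_funB;
    by apply: measurableT_comp; [exact: measurable_ser|exact: measurable_funD].
rewrite (_ : (fun x => _) = \1_(h @^-1` `]-oo, r[)); last first.
  by apply/funext => x; rewrite indicE /h; congr (nat_of_bool _)%:R; apply/idP/idP => [hx|];
    [rewrite inE/= in_itv|rewrite inE/= in_itv].
by apply: measurable_indic; rewrite -[X in measurable X]setTI; exact: mh.
Qed.

(** Within a grid cell the partial sums are Lipschitz, so the enlargement [e] of the radius absorbs
    the passage to the left end of the cell. *)
Lemma integral_close_pairs N L (r e : R) (a : int) : 2 * K * beta ^- L <= e ->
  (\int[leb]_(x in `[(a%:~R)%R, (a%:~R + 1)%R[) (pairs N x r)%:E <=
    (beta ^- L * correlation b g psi N L (r + e))%:E)%E.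
Proof.
move=> Le; have mcp := measurable_close_pairs N r.
have bL : 0 < beta ^+ L by rewrite betaX_gt0.
pose A (j : nat) : set (measurableTypeR R) := [set` `[a%:~R + j%:R / beta ^+ L, a%:~R + j.+1%:R / beta ^+ L[].
pose c (j : nat) := pairs N (j%:R / beta ^+ L) (r + e).
have c0 j : 0 <= c j by exact: close_pairs_ge0.
have -> : beta ^- L * correlation b g psi N L (r + e) = \sum_(j < b ^ L) c j * beta ^- L.
  by rewrite mulrC mulr_suml.
apply: le_trans (@integral_step R _ (b ^ L) c (fun=> beta ^- L) A (measurable_itv _) c0 _ _) => //; last 2 first.
- by move=> m; exact: measurable_itv.
- move=> m; rewrite lebesgue_measure_itv/=; case: ifP => _; last by rewrite lee_fin invr_ge0 ltW.
  by rewrite -EFinD lee_fin -natr1; lra.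
apply: ge0_le_integral => //.
- by move=> x _; rewrite lee_fin close_pairs_ge0.
- by apply/measurable_EFinP; exact: measurable_funTS.
- apply/measurable_EFinP; apply: measurable_funTS; apply: measurable_sum => m.
  by apply: measurable_funM => //; apply: measurable_indic; exact: measurable_itv.
move=> x; rewrite /= in_itv/= => /andP[ax xa].
have t0 : 0 <= (x - a%:~R) * beta ^+ L by rewrite mulr_ge0 ?subr_ge0// ltW.
have /andP[j1 j2] := truncn_itv t0.
set j := Num.truncn _ in j1 j2.
have jL : (j < b ^ L)%N.
  rewrite -(ltr_nat R) natrX; apply: le_lt_trans j1 _.
  by rewrite gtr_pMl//; move: xa; lra.
rewrite lee_fin (bigD1 (Ordinal jL))//=.
have jx1 : j%:R / beta ^+ L <= x - a%:~R by rewrite ler_pdivrMr.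
have jx2 : x - a%:~R < j.+1%:R / beta ^+ L by rewrite ltr_pdivlMr.
rewrite indicE mem_set ?mulr1; last first.
  by rewrite /A /= in_itv/= -lerBrDl jx1/= -ltrBlDl.
apply: (@le_trans _ _ (c j)); last by rewrite lerDl sumr_ge0// => i _; rewrite mulr_ge0.
rewrite -(close_pairs_periodic _ _ _ a); apply: close_pairs_near.
have K0 : 0 <= 2 * K by rewrite mulr_ge0//; exact: tail_const_ge0.
apply: le_trans Le; apply: ler_wpM2l => //.
by rewrite ger0_norm ?subr_ge0//; move: jx2; rewrite -natr1 mulrDl mul1r; lra.
Qed.

End grid_integral.

(** * Energy of the fibre measures and their densities *)

Section srb.
Context {R : realType} (b : nat) (g : R) (d : measure_display) (Omega : measurableType d)
  (P : probability Omega R) (iota : nat -> Omega -> nat).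
Hypothesis b2 : (2 <= b)%N.
Hypotheses (gb : (b%:R : R)^-1 < g) (g1 : g < 1).
Hypothesis model : bernoulli_model b P iota.
Local Notation beta := (b%:R : R).
Local Notation leb := (@lebesgue_measure R).
Local Notation K := (tail_const g).
Local Notation G N := (ser b g 0 N psi).
Local Notation pairs := (close_pairs b g psi).
Local Notation TR := (measurableTypeR R).

Let g0 : 0 < g. Proof. by apply: lt_trans gb; rewrite invr_gt0 beta_gt0. Qed.
Let K0 : 0 <= K. Proof. exact: tail_const_ge0. Qed.

Let S (x : R) (w : Omega) : R := Sfun b g iota x w.

Lemma measurable_S x : @measurable_fun _ _ Omega TR setT (S x).
Proof.
exact: (measurableT_comp (measurable_Sfun b2 g0 g1 model) (g := pair (x : TR)) (pair1_measurable _)).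
Qed.

Definition law x : probability TR R :=
  @distribution _ _ Omega TR R P (@mfun_Sub _ _ Omega TR (S x) (mem_set (measurable_S x))).

Let e k : R := 2 ^- k.
Let e_gt0 k : 0 < e k. Proof. by rewrite invr_gt0 exprn_gt0. Qed.
Let e_cvg0 : e k @[k --> \oo] --> (0 : R).
Proof.
rewrite /e; under eq_fun do rewrite -exprVn.
by apply: cvg_expr; rewrite ger0_norm// invf_lt1// ltr1n.
Qed.

Definition law_mean k (x y : R) : R := ball_mean (law x) (e k) y.

Lemma law_mean_ge0 k x y : 0 <= law_mean k x y.
Proof. exact: ball_mean_ge0. Qed.

Lemma measurable_law_mean k : measurable_fun setT (fun z : TR * TR => law_mean k z.1 z.2).
Proof.
apply: measurable_funM => //; apply: measurableT_comp => //.
pose A := [set t : (TR * TR) * Omega | ball (t.1.2 : R) (e k) (S t.1.1 t.2)].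
rewrite (_ : (fun z => _) = P \o xsection A).
  apply: measurable_fun_xsection.
  rewrite (_ : A = (fun t : (TR * TR) * Omega => `|(t.1.2 : R) - S t.1.1 t.2|) @^-1` `]-oo, e k[).
    rewrite -[X in measurable X]setTI.
    apply: measurableT_comp => //; apply: measurable_funB.
      exact: measurableT_comp.
    apply: (measurableT_comp (measurable_Sfun b2 g0 g1 model) (g := fun t : (TR * TR) * Omega => (t.1.1, t.2))).
    apply/measurable_fun_pairP; split => /=; last exact: measurable_snd.
    exact: (measurableT_comp measurable_fst measurable_fst).
  by apply/seteqP; split => t /=; rewrite in_itv.
apply/funext => -[x y] /=; congr (P _); apply/seteqP; split => w; rewrite /xsection/= inE//.
Qed.

(** Truncation to [N] digits moves S by at most [e k], which doubles the radius. *)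
Lemma law_mean_le k N x y : K * g ^+ N <= e k ->
  law_mean k x y <= (2 * e k)^-1 * (beta ^- N *
    \sum_(m < b ^ N) (`|y - G N (x + m%:R)| < 2 * e k)%R%:R).
Proof.
move=> Nk; rewrite /law_mean /ball_mean mulrC ler_wpM2l ?invr_ge0 ?mulr_ge0 ?(ltW (e_gt0 _))//.
pose Q m := `|y - G N (x + m%:R)| < 2 * e k.
have QP : (law x (ball y (e k)) <= (beta ^- N * \sum_(m < b ^ N) (Q m)%:R)%:E)%E.
  apply: le_trans (word_law_le b2 model N Q).
  rewrite (_ : law x _ = P (S x @^-1` ball y (e k)))//.
  apply: le_measure; rewrite ?inE.
  - by have := measurable_S x measurableT (measurable_ball y (e k)); rewrite setTI.
  - by have := measurable_word model N measurableT (Y := [set m | Q m]) I; rewrite setTI.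
  - move=> w /= Sy; rewrite /Q.
    have := @Sfun_dist R b g b2 g0 g1 Omega iota N x w.
    move: Sy; rewrite /ball/= -/(S x w); set s := S x w; set u := G _ _ => ys su.
    have -> : y - u = (y - s) + (s - u) by ring.
    apply: le_lt_trans (ler_normD _ _) _; move: Nk ys su; lra.
have fin : law x (ball y (e k)) \is a fin_num.
  by apply: fin_num_measure; exact: measurable_ball.
by rewrite -lee_fin (fineK fin).
Qed.

(** The square of the count is a sum over pairs [(m, n)]. A pair contributes only if [u m] and [u n]
    are within [4 * e k], and then only for [y] in a ball of length [4 * e k]. *)
Lemma law_mean_sqr_integral k N x : K * g ^+ N <= e k ->
  (\int[leb]_y ((law_mean k x y) ^+ 2)%:E <=
    ((e k)^-1 * beta ^- (2 * N) * pairs N x (4 * e k))%:E)%E.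
Proof.
move=> Nk; have ek := e_gt0 k.
pose u m := G N (x + m%:R).
pose q : R := ((2 * e k)^-1 * beta ^- N) ^+ 2.
have q0 : 0 <= q by exact: sqr_ge0.
pose c (m : nat) := q * \sum_(n < b ^ N) (`|u m - u n| < 4 * e k)%R%:R.
have c0 m : 0 <= c m by rewrite mulr_ge0// sumr_ge0.
pose A (m : nat) : set TR := ball (u m) (2 * e k).
have mA m : measurable (A m) by exact: measurable_ball.
apply: (@le_trans _ _ (\int[leb]_y (\sum_(m < b ^ N) c m * \1_(A m) y)%:E)%E).
  apply: ge0_le_integral => //.
  - by move=> y _; rewrite lee_fin sqr_ge0.
  - by apply/measurable_EFinP; apply: measurable_funX; exact: measurable_ball_mean.
  - by apply/measurable_EFinP; apply: measurable_sum => m; apply: measurable_funM.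
  move=> y _; rewrite lee_fin.
  pose s := \sum_(m < b ^ N) (`|y - u m| < 2 * e k)%R%:R : R.
  have h : law_mean k x y ^+ 2 <= q * (s * s).
    rewrite /q -expr2 -exprMn ler_pXn2r ?nnegrE ?law_mean_ge0//.
      by rewrite -mulrA; exact: law_mean_le.
    by rewrite !mulr_ge0 ?sumr_ge0 ?invr_ge0 ?mulr_ge0 ?exprn_ge0 ?(ltW ek).
  apply: le_trans h _; rewrite mulr_suml mulr_sumr; apply: ler_sum => m _.
  rewrite /c -mulrA ler_wpM2l// mulr_suml mulr_sumr; apply: ler_sum => n _.
  rewrite indicE -!natrM ler_nat.
  case: (ltP `|y - u m| _) => //= hm; rewrite mul1n.
  case: (ltP `|y - u n| _) => //= hn.
  rewrite (mem_set (_ : A m y)) ?muln1; last by rewrite /A/= /ball/= distrC.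
  rewrite lt0b; have -> : u m - u n = (y - u n) - (y - u m) by ring.
  by apply: le_lt_trans (ler_normB _ _) _; move: hm hn; lra.
apply: le_trans (@integral_step R setT (b ^ N) c (fun=> 4 * e k) A _ c0 mA _) _ => //.
  move=> m; rewrite lebesgue_measure_ball; last by rewrite mulr_ge0// ltW.
  by rewrite lee_fin -mulr_natl; lra.
rewrite lee_fin -mulr_suml -mulr_sumr -/(pairs N x (4 * e k)).
rewrite le_eqVlt; apply/orP; left; apply/eqP.
rewrite /q (mulnC 2) exprM /close_pairs /pair_diff; set C := \sum_(_ < _) _.
field.
by rewrite !gt_eqF// betaX_gt0.
Qed.

Local Open Scope ereal_scope.

(** The lower limit is what Fatou's lemma controls from bounds in mean over [x]; when finite it
    yields a subsequence of radii with bounded L^2 norms. *)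
Definition energy x : \bar R := limn_einf (fun k => \int[leb]_y ((law_mean k x y ^+ 2)%R)%:E).

Lemma energy_ge0 x : 0 <= energy x.
Proof.
by apply: limn_einf_ge0 => k; apply: integral_ge0 => y _; rewrite lee_fin sqr_ge0.
Qed.

Lemma measurable_law_mean_integral k :
  measurable_fun setT (fun x : TR => \int[leb]_y ((law_mean k x y ^+ 2)%R)%:E).
Proof.
apply: (@measurable_fun_fubini_tonelli_F _ _ TR TR R leb
  (fun z : TR * TR => ((law_mean k z.1 z.2 ^+ 2)%R)%:E)).
  by apply/measurable_EFinP; apply: measurable_funX; exact: measurable_law_mean.
by move=> z; rewrite lee_fin sqr_ge0.
Qed.

Lemma measurable_energy : measurable_fun setT (energy : TR -> \bar R).
Proof. by apply: measurable_fun_limn_einf => k; exact: measurable_law_mean_integral. Qed.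

Lemma energy_integral : exists C : R, forall a : int,
  \int[leb]_(x in `[(a%:~R)%R, (a%:~R + 1)%R[) energy x <= C%:E.
Proof.
have [C C0 hC] := psi_correlation_bound b2 gb g1.
exists (5 * C)%R => a.
have mean_bound k : \int[leb]_(x in `[(a%:~R)%R, (a%:~R + 1)%R[)
    \int[leb]_y ((law_mean k x y ^+ 2)%R)%:E <= (5 * C)%:E.
  have ek := e_gt0 k.
  have K1 : (0 < K + 1)%R by rewrite ltr_wpDl.
  have K2 : (0 < 2 * K + 1)%R by rewrite ltr_wpDl// mulr_ge0.
  (* [N] and [L] bring the truncation and grid errors below [e k] and also meet the conditions of
     the correlation bound at radius [5 * e k], which explains the constant [5 * C]. *)
  have [N hN] : exists N, (g ^+ N < e k / (K + 1))%R.
    by apply: expr_small; rewrite ?g0 ?g1// divr_gt0.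
  have [L hL] : exists L, ((beta^-1) ^+ L < e k / (2 * K + 1))%R.
    apply: expr_small; last by rewrite divr_gt0.
    by rewrite invr_gt0 beta_gt0//= invf_lt1 ?beta_gt0// ltr1n.
  have gN : (K * g ^+ N + g ^+ N < e k)%R.
    by move: hN; rewrite ltr_pdivlMr// mulrDr mulr1 mulrC.
  have bL : (2 * K * beta ^- L + beta ^- L < e k)%R.
    by move: hL; rewrite ltr_pdivlMr// mulrDr mulr1 mulrC exprVn.
  have gN0 : (0 < g ^+ N)%R by rewrite exprn_gt0.
  have bL0 : (0 < beta ^- L)%R by rewrite betaVX_gt0.
  have KgN : (0 <= K * g ^+ N)%R by rewrite mulr_ge0// ltW.
  have KbL : (0 <= 2 * K * beta ^- L)%R by rewrite mulr_ge0 ?(ltW bL0)// mulr_ge0.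
  have gNe : (K * g ^+ N <= e k)%R by move: gN; lra.
  have bLe : (2 * K * beta ^- L <= e k)%R by move: bL; lra.
  pose q := ((e k)^-1 * beta ^- (2 * N))%R.
  have q0 : (0 <= q)%R by rewrite mulr_ge0// invr_ge0 ?exprn_ge0// ltW.
  apply: (@le_trans _ _ (\int[leb]_(x in `[(a%:~R)%R, (a%:~R + 1)%R[)
     (q%:E * (pairs N x (4 * e k))%:E))).
    apply: ge0_le_integral => //.
    - by move=> x _; apply: integral_ge0 => y _; rewrite lee_fin sqr_ge0.
    - by apply: measurable_funTS; exact: measurable_law_mean_integral.
    - apply: measurable_funTS; apply: emeasurable_funM => //.
      by apply/measurable_EFinP; exact: measurable_close_pairs.
    - by move=> x _; rewrite -EFinM; exact: law_mean_sqr_integral.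
  rewrite ge0_integralZl//; last 2 first.
    by apply: measurable_funTS; apply/measurable_EFinP; exact: measurable_close_pairs.
    by move=> x _; rewrite lee_fin close_pairs_ge0.
  apply: (@le_trans _ _ (q%:E * (beta ^- L * correlation b g psi N L (4 * e k + e k))%:E)).
    by apply: lee_wpmul2l; rewrite ?lee_fin//; exact: integral_close_pairs.
  rewrite -EFinM lee_fin.
  have h : (correlation b g psi N L (4 * e k + e k) <= C * (4 * e k + e k) * beta ^+ (L + 2 * N))%R.
    by apply: hC; [move: gN KgN|move: bL KbL]; lra.
  apply: (@le_trans _ _ (q * (beta ^- L * (C * (4 * e k + e k) * beta ^+ (L + 2 * N))))%R).
    by rewrite ler_wpM2l// ler_wpM2l// ltW.
  rewrite /q exprD le_eqVlt; apply/orP; left; apply/eqP; field.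
  by rewrite !gt_eqF// betaX_gt0.
apply: le_trans (fatou _ _ _ _) _ => //.
- by move=> k; apply: measurable_funTS; exact: measurable_law_mean_integral.
- by move=> k x _; apply: integral_ge0 => y _; rewrite lee_fin sqr_ge0.
exact: limn_einf_le.
Qed.

Lemma ae_imply (Q Q' : R -> Prop) : (forall x, Q x -> Q' x) ->
  {ae leb, forall x, Q x} -> {ae leb, forall x, Q' x}.
Proof.
move=> QQ' [A [mA A0 QA]]; exists A; split => // x nQ'.
by apply: QA => Qx; apply: nQ'; exact: QQ'.
Qed.

Lemma energy_lty : {ae leb, forall x, energy x < +oo}.
Proof.
have [C hC] := energy_integral.
(* The countably many unit intervals are enumerated by [unpickle] so that the null sets can be
   united. *)
have h (n : nat) : {ae leb, forall x, forall a : int, unpickle n = Some a ->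
    x \in `[(a%:~R)%R, (a%:~R + 1)%R[ -> energy x < +oo}.
  case E : (unpickle n) => [a|]; last by apply: aeW.
  have ie : leb.-integrable `[(a%:~R)%R, (a%:~R + 1)%R[ energy.
    apply/integrableP; split; first by apply: measurable_funTS; exact: measurable_energy.
    under eq_integral do rewrite gee0_abs ?energy_ge0//.
    exact: le_lt_trans (hC a) (ltry _).
  have mI : measurable ([set` `[(a%:~R)%R, (a%:~R + 1)%R[] : set TR) by exact: measurable_itv.
  apply: ae_imply (integrable_ae mI ie) => x hx _ [<-] xa; rewrite -ge0_fin_numE ?energy_ge0//; exact: hx.
apply: ae_imply (ae_foralln h) => x /(_ (pickle (Num.floor x))) /(_ (Num.floor x)); rewrite pickleK; apply => //.
by have := floor_itv x; rewrite in_itv/= intrD.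
Qed.

Lemma measurable_law_section (B : set (TR * TR)) : measurable B ->
  measurable_fun setT (fun x : TR => law x [set y | B (x, y)]).
Proof.
move=> mB; pose h (t : TR * Omega) : TR * TR := (t.1, S t.1 t.2).
have mh : measurable_fun setT h.
  apply/measurable_fun_pairP; split; first exact: measurable_fst.
  exact: (measurable_Sfun b2 g0 g1 model).
rewrite (_ : (fun x => _) = P \o xsection (h @^-1` B)).
  by apply: measurable_fun_xsection; rewrite -[X in measurable X]setTI; exact: mh.
by apply/funext => x /=; congr (P _); apply/seteqP; split => w; rewrite /xsection/= inE.
Qed.

(** An upper limit over all radii gives a jointly measurable version, unlike Radon-Nikodym densities
    chosen separately for each [x]. Infinite upper limits are sent to 0 by [fine]. *)
Definition srb_density (z : R * R) : R := fine (limn_esup (fun k => (law_mean k z.1 z.2)%:E)).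

Lemma srb_density_ge0 z : (0 <= srb_density z)%R.
Proof.
apply: fine_ge0; apply: le_trans (limn_einf_sup _).
by apply: limn_einf_ge0 => k; rewrite lee_fin law_mean_ge0.
Qed.

Lemma measurable_srb_density : measurable_fun setT (srb_density : TR * TR -> R).
Proof.
apply: measurableT_comp => //; apply: measurable_fun_limn_esup => k.
by apply/measurable_EFinP; exact: measurable_law_mean.
Qed.

Lemma measurable_srb_density1 x : measurable_fun setT (fun y : TR => srb_density (x, y)).
Proof. exact: (measurableT_comp measurable_srb_density (g := pair (x : TR)) (pair1_measurable _)). Qed.

Lemma srb_density_law (H : R) x : energy x < H%:E ->
  \int[leb]_y ((srb_density (x, y) ^+ 2)%R)%:E <= H%:E /\
  (forall A : set TR, measurable A -> law x A = \int[leb]_(y in A) (srb_density (x, y))%:E).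
Proof.
move=> xH.
have H0 : (0 <= H)%R by rewrite -lee_fin (le_trans (energy_ge0 x))// ltW.
have freq n : exists k, (n <= k)%N /\ \int[leb]_y ((law_mean k x y ^+ 2)%R)%:E <= H%:E.
  by have [k nk kH] := limn_einf_frequently xH n; exists k; split => //; exact: ltW.
have [sg sgP] := choice freq.
have sg_cvg0 : e (sg n) @[n --> \oo] --> (0 : R)%R.
  apply: (squeeze_cvgr _ (cvg_cst 0%R) e_cvg0); apply: nearW => n.
  rewrite (ltW (e_gt0 _))/= /e lef_pV2 ?posrE ?exprn_gt0// ler_eXn2l ?ltr1n//.
  by have [] := sgP n.
have [f [mf f0 fH lawf fcvg]] := ball_means_density (fun n => e_gt0 (sg n)) sg_cvg0 H0
  (fun n => (sgP n).2).
have densf : {ae leb, forall y, srb_density (x, y) = f y}.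
  apply: ae_imply (fcvg e e_gt0 e_cvg0) => y h.
  by rewrite /srb_density /law_mean /=; have [_ ->] := cvg_limn_einf_sup h.
split.
  rewrite (@ge0_ae_eq_integral _ TR R leb setT _ (fun y => ((f y ^+ 2)%R)%:E))//.
  - by apply/measurable_EFinP; apply: measurable_funX; exact: measurable_srb_density1.
  - by apply/measurable_EFinP; apply: measurable_funX.
  - by move=> y _; rewrite lee_fin sqr_ge0.
  - by move=> y _; rewrite lee_fin sqr_ge0.
  - by apply: ae_imply densf => y -> _.
move=> A mA; rewrite lawf//; apply: ge0_ae_eq_integral => //.
- by apply/measurable_EFinP; exact: measurable_funTS.
- by apply/measurable_EFinP; apply: measurable_funTS; exact: measurable_srb_density1.
- by move=> y _; rewrite lee_fin.
- by move=> y _; rewrite lee_fin srb_density_ge0.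
- by apply: ae_imply densf => y -> _.
Qed.

End srb.

(** * Tonelli's theorem on vertical strips *)

Section strip.
Context {R : realType}.
Local Notation leb := (@lebesgue_measure R).
Local Notation TR := (measurableTypeR R).
Local Open Scope ereal_scope.

Lemma strip_integral (D : set TR) (B : set (TR * TR)) (F : TR * TR -> \bar R) :
  measurable D -> measurable B -> measurable_fun setT F -> (forall z, 0 <= F z) ->
  \int[leb \x leb]_(z in B `&` (D `*` setT)) F z =
  \int[leb]_(x in D) \int[leb]_(y in [set y | B (x, y)]) F (x, y).
Proof.
move=> mD mB mF F0.
have mA : measurable (B `&` (D `*` setT)) by apply: measurableI => //; exact: measurableX.
rewrite integral_mkcond fubini_tonelli1; last 2 first.
- by apply/(measurable_restrictT _ mA); exact: measurable_funTS.
- by move=> z; rewrite patchE; case: ifP.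
rewrite [RHS]integral_mkcond; apply: eq_integral => x _.
rewrite /fubini_F [in RHS]patchE; case: ifPn => xD.
  rewrite [RHS]integral_mkcond; apply: eq_integral => y _; rewrite !patchE.
  congr (if _ then _ else _); apply/idP/idP; rewrite !inE /=; first by case.
  by move=> Bxy; split => //; split => //; rewrite inE in xD.
rewrite integral0_eq// => y _; rewrite patchE ifF//.
apply/negbTE; apply: contra xD; rewrite !inE /= => -[_ []//].
Qed.

Lemma measurable_section (B : set (TR * TR)) x : measurable B ->
  measurable ([set y | B (x, y)] : set TR).
Proof.
move=> mB; rewrite (_ : [set y | B (x, y)] = xsection B x); first exact: measurable_xsection.
by apply/seteqP; split => y; rewrite /xsection/= inE.
Qed.

Lemma measurable_section_integral (B : set (TR * TR)) (F : TR * TR -> \bar R) :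
  measurable B -> measurable_fun setT F -> (forall z, 0 <= F z) ->
  measurable_fun setT (fun x : TR => \int[leb]_(y in [set y | B (x, y)]) F (x, y)).
Proof.
move=> mB mF F0.
rewrite (_ : (fun x => _) = fubini_F leb (F \_ B)).
  apply: measurable_fun_fubini_tonelli_F; last by move=> z; rewrite patchE; case: ifP.
  by apply/(measurable_restrictT _ mB); exact: measurable_funTS.
apply/funext => x; rewrite integral_mkcond; apply: eq_integral => y _; rewrite !patchE.
by congr (if _ then _ else _); apply/idP/idP; rewrite !inE.
Qed.

End strip.

Theorem theorem1p3 (R : realType) (b : nat) (gamma : R)
  (d : measure_display) (Omega : measurableType d) (P : probability Omega R)
  (iota : nat -> Omega -> nat) :
  (2 <= b)%N -> (b%:R : R)^-1 < gamma -> gamma < 1 ->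
  bernoulli_model b P iota ->
  (exists f : R * R -> R,
     [/\ measurable_fun setT f,
         (forall z, 0 <= f z),
         (\int[(@lebesgue_measure R \x @lebesgue_measure R)%E]_(z in `[0%R, 1%R[ `*` setT)
             ((f z) ^+ 2)%:E < +oo)%E &
         (forall B : set (R * R), measurable B ->
            vartheta b gamma P iota B =
            (\int[(@lebesgue_measure R \x @lebesgue_measure R)%E]_(z in B `&` (`[0%R, 1%R[ `*` setT))
               (f z)%:E)%E)])
  /\
  {ae @lebesgue_measure R, forall x : R,
     exists g : R -> R,
       [/\ measurable_fun setT g,
           (forall y, 0 <= g y),
           (\int[@lebesgue_measure R]_y ((g y) ^+ 2)%:E < +oo)%E &
           (forall A : set R, measurable A ->
              m_x b gamma P iota x A = (\int[@lebesgue_measure R]_(y in A) (g y)%:E)%E)]}.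
Proof.
move=> b2 gb g1 model.
pose f := srb_density b2 gb g1 model.
pose en := energy b2 gb g1 model.
have f0 z : 0 <= f z by exact: srb_density_ge0.
have mf := measurable_srb_density b2 gb g1 model.
have mf1 := measurable_srb_density1 b2 gb g1 model.
have en_lty := energy_lty b2 gb g1 model.
have flaw x : (en x < +oo)%E ->
    (\int[@lebesgue_measure R]_y ((f (x, y) ^+ 2)%R)%:E <= en x)%E /\
    (forall A : set R, measurable A ->
       m_x b gamma P iota x A = (\int[@lebesgue_measure R]_(y in A) (f (x, y))%:E)%E).
  move=> xoo.
  have xfin : en x \is a fin_num by rewrite ge0_fin_numE// energy_ge0.
  split; last first.
    have h : (en x < (fine (en x) + 1)%:E)%E by rewrite EFinD fineK// lteDl.
    by have [_] := srb_density_law h.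
  (* [srb_density_law] takes a number strictly above the energy, so an arbitrary excess [e] is
     allowed first. *)
  apply/lee_addgt0Pr => e e0.
  have h : (en x < (fine (en x) + e)%:E)%E by rewrite EFinD fineK// lteDl.
  by rewrite -[X in (X + _)%E](fineK xfin) -EFinD; have [] := srb_density_law h.
split.
  exists f; split => //.
  - have mf2 : measurable_fun setT (fun z : measurableTypeR R * measurableTypeR R => ((f z ^+ 2)%R)%:E).
      by apply/measurable_EFinP; exact: measurable_funX.
    have f20 z : (0 <= ((f z ^+ 2)%R)%:E)%E by rewrite lee_fin sqr_ge0.
    have := @strip_integral R `[0, 1[%classic setT _ (measurable_itv _) measurableT mf2 f20.
    rewrite setTI => ->.
    (* Fibrewise the squared norm is at most the energy, whose integral over [0, 1) is bounded by
       the case [a = 0]. *)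
    have [C hC] := energy_integral b2 gb g1 model.
    apply: le_lt_trans (ltry C); have := hC 0; rewrite add0r; apply: le_trans.
    apply: ae_ge0_le_integral => //.
    + by move=> x _; exact: integral_ge0.
    + by apply: measurable_funTS; exact: (measurable_section_integral measurableT mf2 f20).
    + by move=> x _; exact: energy_ge0.
    + by apply: measurable_funTS; exact: measurable_energy.
    by apply: ae_imply en_lty => x /flaw[+ _] _.
  - move=> B mB.
    have mfE : measurable_fun setT (fun z : measurableTypeR R * measurableTypeR R => (f z)%:E).
      exact/measurable_EFinP.
    have f0E z : (0 <= (f z)%:E)%E by rewrite lee_fin.
    rewrite (@strip_integral R `[0, 1[%classic B _ (measurable_itv _) mB mfE f0E).
    rewrite /vartheta; apply: ge0_ae_eq_integral => //.
    + by apply: measurable_funTS; exact: (measurable_law_section b2 gb g1 model mB).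
    + by apply: measurable_funTS; exact: (measurable_section_integral mB mfE f0E).
    + by move=> x _; rewrite /m_x /pushforward; exact: measure_ge0.
    + by move=> x _; exact: integral_ge0.
    apply: ae_imply en_lty => x /flaw[_ +] _; apply.
    exact: measurable_section.
apply: ae_imply en_lty => x xoo; have [f2 fA] := flaw x xoo.
exists (fun y => f (x, y)); split => //; first exact: mf1.
exact: le_lt_trans f2 xoo.
Qed.
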